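(* For all constants $c\ge 1$, $c_0\ge 1$ and $\delta\ge 0$ there exists a constant $b\ge 1$, depending only on $c$, $c_0$ and $\delta$, such that the following holds. Let $E$ be a real Banach space of dimension at least $2$ and let $D\subsetneq E$ be a $c$-John domain such that $(D,k_D)$ is $\delta$-hyperbolic, where $k_D$ is the quasihyperbolic metric of $D$. Then every $c_0$-neargeodesic in $D$ is a $b$-cone arc.
   Context: A domain is a nonempty open connected set. For a domain $D\subsetneq E$ in a real Banach space $E$ with norm $|\cdot|$, and $z\in D$, let $\Delta(z)=d(z,\partial D)$ be the norm distance from $z$ to the boundary $\partial D$. $l(\gamma)$ denotes the length of a curve $\gamma$ with respect to the norm. For a curve $\gamma$ and points $u,v$ on it, $\gamma[u,v]$ denotes the part of $\gamma$ between $u$ and $v$. Quasihyperbolic metric: the quasihyperbolic length of a rectifiable curve $\gamma$ in $D$ is $l_k(\gamma)=\int_\gamma \frac{ds}{\Delta(z)}$ ($ds$ is norm arc length), and $k_D(x,y)=\inf_\gamma l_k(\gamma)$, the infimum being over all rectifiable curves $\gamma$ in $D$ joining $x$ to $y$. Neargeodesic: for $c_0\ge 1$, a curve $\gamma$ in $D$ is a $c_0$-neargeodesic if $l_k(\gamma[u,v])\le c_0\,k_D(u,v)$ for all $u,v\in\gamma$. A neargeodesic joins its two endpoints $x,y\in D$. Cone arc: for $b\ge 1$, a rectifiable curve $\gamma$ in $D$ joining $x$ to $y$ is a $b$-cone arc if $\min\{l(\gamma[x,z]),\,l(\gamma[z,y])\}\le b\,\Delta(z)$ for all $z\in\gamma$.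 John domain: for $c\ge 1$, $D$ is a $c$-John domain if every pair of points $x,y\in D$ can be joined by a $c$-cone arc in $D$. Gromov hyperbolicity: for a metric space $(X,d)$ and $p\in X$, the Gromov product is $(x|y)_p=\frac12\big(d(x,p)+d(y,p)-d(x,y)\big)$. $(X,d)$ is $\delta$-hyperbolic if $(x|z)_p\ge\min\{(x|y)_p,(y|z)_p\}-\delta$ for all $x,y,z,p\in X$. *)

(* Defs.v *)
From HB Require Import structures.
From mathcomp Require Import all_boot all_order all_algebra.
From mathcomp Require Import all_classical all_reals all_analysis.

Set Implicit Arguments.
Unset Strict Implicit.
Unset Printing Implicit Defensive.

Import Order.TTheory GRing.Theory Num.Theory.
Import numFieldNormedType.Exports.

Local Open Scope classical_set_scope.
Local Open Scope ring_scope.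

Definition dim_ge2 (R : realType) (E : normedModType R) : Prop :=
  exists u v : E, forall s t : R, s *: u + t *: v = 0 -> s = 0 /\ t = 0.

Definition domain (T : topologicalType) (D : set T) : Prop :=
  [/\ D !=set0, open D & connected D].

Definition boundary (T : topologicalType) (D : set T) : set T :=
  closure D `\` interior D.

Section Curves.
Context {R : realType} {E : normedModType R}.
Implicit Types (D : set E) (g : R -> E) (a b s t : R).

Definition bdist D (z : E) : R := inf [set `|z - w| | w in boundary D].

(* A curve is a map g : R -> E considered on a parameter interval [a, b]; the
   part of it between the points g s and g t, s <= t, is g on [s, t]. The
   length is the supremum of the lengths of inscribed polygons, written as in
   realfun's total_variation, which covers real-valued functions only. *)
Definition curve_length g a b : \bar R :=
  ereal_sup [set (\sum_(0 <= i < size p)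
                    `|g (nth b (a :: p) i.+1) - g (nth b (a :: p) i)|)%:E
            | p in [set p : seq R | itv_partition a b p]].

Definition curve_in D g a b : Prop :=
  [/\ a <= b, {within `[a, b], continuous g} & g @` `[a, b] `<=` D].

Definition rectifiable_in D g a b : Prop :=
  curve_in D g a b /\ (curve_length g a b < +oo)%E.

(* Arc length parametrization of g on [a, b]: the point of the curve at arc
   length u from g a. For a rectifiable curve and u in [0, length] a parameter
   t as below exists, and the point g t does not depend on its choice. *)
Definition arc_param g a b (u : R) : E :=
  g (xget a [set t | t \in `[a, b] /\ curve_length g a t = u%:E]).

(* Integral of 1 / bdist with respect to arc length; meaningful for rectifiable
   curves only. *)
Definition qh_length D g a b : \bar R :=
  (\int[lebesgue_measure]_(u in `[0%R, fine (curve_length g a b)])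
     ((bdist D (arc_param g a b u))^-1)%:E)%E.

(* The infimum is finite for x, y in a proper subdomain D. *)
Definition qh_dist D (x y : E) : R :=
  fine (ereal_inf [set l : \bar R | exists g a b,
    [/\ rectifiable_in D g a b, g a = x, g b = y & l = qh_length D g a b]]).

(* The quasihyperbolic length of a nonrectifiable curve in D is infinite, so
   neargeodesics are rectifiable. *)
Definition neargeodesic D (c0 : R) g a b : Prop :=
  rectifiable_in D g a b /\
  forall s t, a <= s -> s <= t -> t <= b ->
    (qh_length D g s t <= (c0 * qh_dist D (g s) (g t))%:E)%E.

Definition cone_arc D (c : R) g a b : Prop :=
  rectifiable_in D g a b /\
  forall t, a <= t -> t <= b ->
    (Order.min (curve_length g a t) (curve_length g t b)
       <= (c * bdist D (g t))%:E)%E.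

Definition john_domain (c : R) D : Prop :=
  domain D /\ forall x y, D x -> D y ->
    exists g a b, [/\ cone_arc D c g a b, g a = x & g b = y].

End Curves.

Definition gromov_product (R : realType) (X : Type) (d : X -> X -> R)
  (p x y : X) : R := (d x p + d y p - d x y) / 2.

Definition gromov_hyperbolic (R : realType) (X : Type) (A : set X)
    (d : X -> X -> R) (delta : R) : Prop :=
  forall x y z p, A x -> A y -> A z -> A p ->
    Num.min (gromov_product d p x y) (gromov_product d p y z) - delta
      <= gromov_product d p x z.

(* Main.v *)
Require Import Defs.
From HB Require Import structures.
From mathcomp Require Import all_boot all_order all_algebra.
From mathcomp Require Import all_classical all_reals all_analysis.
From mathcomp Require Import lra.

(** Write k for the quasihyperbolic metric, Delta for the distance to the
    boundary and C = 1 + 2c. The proof rests on one observation: half of a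
    c-cone arc is a quasigeodesic of (D, k). If f is the half starting at x,
    parametrized by arc length s, then Delta is 1-Lipschitz and s is at most
    c Delta(f s), so Delta(f s) lies between (Delta(x) + s) / C and
    Delta(x) + s. The upper bound for 1 / Delta gives
    k(f s, f t) <= C ln ((Delta(x) + t) / (Delta(x) + s)), and the general
    inequality |ln (Delta(y) / Delta(x))| <= k(x, y) gives the opposite
    estimate up to constants (john_ray_quasigeodesic).

    Thus the two halves of a cone arc from x to y through its midpoint m,
    together with a neargeodesic from x to y, form a triangle of
    quasigeodesics. Stability of quasigeodesics in a hyperbolic space
    (near_quasigeodesic, neargeodesic_near_thin_point) puts every point z of
    the neargeodesic within a bounded k-distance of one of the two halves,
    say of a point w = f s of the half at x. If moreover Delta(z) is at most
    2 Delta(x), then Delta(x) + s <= C Delta(w) is bounded by a multiple of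
    Delta(x), so w, and with it z, lies within a bounded k-distance of x.
    Hence a piece of the neargeodesic on which Delta is at most twice its
    value at either end consists of points k-close to one of the two ends; by
    connectedness the ends are close to each other, and by the neargeodesic
    property the piece has bounded quasihyperbolic length
    (doubling_piece_length). So Delta on the piece is comparable to its value
    at either end, and the length of the piece is at most a constant times
    that value.

    The rest is a statement about the 1-Lipschitz function q = Delta along the
    neargeodesic (carrot_up_to_max): up to a point where q is maximal, cut the
    curve at the first times where q reaches successive halvings of a record
    value. The pieces have lengths bounded by a geometric series, so the
    length travelled is at most a multiple of q. Beyond the maximum the same
    argument applies to the reversed curve.

    The metric properties of k (symmetry, triangle inequality, k being a
    length metric) are obtained from curves parametrized by arc length, where
    the quasihyperbolic length is an increment of a primitive of 1 / Delta;
    the arc length parametrization exists because the length of a rectifiable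
    curve takes all intermediate values (curve_length_ivt). *)

Import Order.TTheory GRing.Theory Num.Theory.
Import numFieldNormedType.Exports.

Set Implicit Arguments.
Unset Strict Implicit.
Unset Printing Implicit Defensive.

Local Open Scope classical_set_scope.
Local Open Scope ring_scope.

(** * Quasigeodesics in hyperbolic length spaces *)

Definition metric_on {R : realType} {X : Type} (A : set X) (d : X -> X -> R) :=
  [/\ forall x, A x -> d x x = 0,
      forall x y, A x -> A y -> 0 <= d x y,
      forall x y, A x -> A y -> d x y = d y x &
      forall x y z, A x -> A y -> A z -> d x z <= d x y + d y z].

(** The clock phi bounds distances along f, as the length of an initial
    arc does. Requiring the intermediate values of phi, and not its continuity,
    lets explicit functions such as a logarithm serve as clocks and is all that
    the bisections below use. *)
Definition clocked_path {R : realType} {X : Type} (A : set X) (d : X -> X -> R)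
    (f : R -> X) (phi : R -> R) (s t : R) :=
  [/\ s <= t,
      forall u, s <= u -> u <= t -> A (f u),
      forall u v, s <= u -> u <= v -> v <= t -> d (f u) (f v) <= phi v - phi u &
      forall u v r, s <= u -> u <= v -> v <= t -> phi u <= r -> r <= phi v ->
        exists w, [/\ u <= w, w <= v & phi w = r]].

Definition length_metric_on {R : realType} {X : Type} (A : set X)
    (d : X -> X -> R) :=
  forall x y e, A x -> A y -> 0 < e -> exists f phi s t,
    [/\ clocked_path A d f phi s t, f s = x, f t = y &
        phi t - phi s <= d x y + e].

Lemma linear_below_exp2 {R : realType} (a b : R) : exists m0 : nat,
  forall m : nat, (m0 <= m)%N -> a * m%:R + b <= 2 ^+ m.
Proof.
(* For large m, 2 ^ m >= m ^ 2 / 4 >= (|a| + 1) * m >= a * m + b. *)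
have quad (m : nat) : (m%:R : R) ^+ 2 <= 4 * 2 ^+ m.
  case: m => [|m]; first by rewrite expr0n expr0 /=; lra.
  elim: m => [|m IH]; first by rewrite expr1n expr1; lra.
  case: m IH => [|m IH]; first by move=> _; rewrite -!natrX -natrM ler_nat.
  case: m IH => [|m IH]; first by move=> _; rewrite -!natrX -natrM ler_nat.
  rewrite (exprS 2); set x := m.+3%:R in IH *; set y := 2 ^+ m.+3 in IH *.
  have -> : (m.+4%:R : R) = x + 1 by rewrite -natr1.
  have x3 : 3 <= x by rewrite ler_nat.
  clearbody x y; rewrite expr2 in IH; rewrite expr2; nra.
pose k := (Num.truncn (4 * (`|a| + 1)) + Num.truncn (`|b|)).+1.
exists (k.+2)%N => m km.
have mR : (k.+2)%:R <= m%:R :> R by rewrite ler_nat.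
have ha : 4 * (`|a| + 1) <= m%:R.
  apply: le_trans (_ : k%:R <= _); last by rewrite ler_nat; do 2 apply: ltnW.
  apply/ltW/(lt_le_trans (truncnS_gt _)).
  by rewrite ler_nat ltnS leq_addr.
have hb : `|b| <= m%:R.
  apply: le_trans (_ : k%:R <= _); last by rewrite ler_nat; do 2 apply: ltnW.
  apply/ltW/(lt_le_trans (truncnS_gt _)).
  by rewrite ler_nat ltnS leq_addl.
have := quad m; have := ler_norm a; have := ler_norm b.
have := normr_ge0 a; have := normr_ge0 b.
set y := m%:R in ha hb mR *; set z := 2 ^+ m; nra.
Qed.

(** This is the comparison of a logarithm with a linear function that closes
    the stability argument: m is about log2 (a * r + b), and del * m must be
    small compared with r. *)
Lemma log_beats_linear {R : realType} (del a b : R) :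
  0 <= del -> 0 <= a -> 0 <= b ->
  exists M : R, forall r, M <= r ->
    exists2 m : nat, a * r + b <= 2 ^+ m & del * m%:R <= r / 4.
Proof.
move=> d0 a0 b0.
have [m0 hm0] := linear_below_exp2 (a * (4 * (del + 1))) (a * (4 * (del + 1)) + b).
exists (4 * (del + 1) * m0.+1%:R) => r hr.
have dp : 0 < 4 * (del + 1) by lra.
have r0 : 0 <= r / (4 * (del + 1)).
  by rewrite divr_ge0 ?(ltW dp)// (le_trans _ hr)// mulr_ge0// ltW.
have hm := truncn_itv r0.
exists (Num.truncn (r / (4 * (del + 1)))).
- apply: le_trans (hm0 _ _); last first.
    rewrite truncn_ge_nat//.
    by rewrite ler_pdivlMr// mulrC (le_trans _ hr)// ler_pM2l// ler_nat.
  move: hm; set m := Num.truncn _ => /andP[_].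
  rewrite ltr_pdivrMr// -natr1 => H; nra.
- move: hm; set m := Num.truncn _ => /andP[+ _].
  rewrite ler_pdivlMr// => H.
  have : 0 <= m%:R :> R by [].
  nra.
Qed.

Section hyperbolic.
Context {R : realType} {X : Type} {A : set X} {d : X -> X -> R} {del : R}.
Hypothesis Ad : metric_on A d.
Hypothesis del0 : 0 <= del.
Hypothesis hyp : gromov_hyperbolic A d del.
Implicit Types (f : R -> X) (phi : R -> R).

Local Notation gp := (gromov_product d).

Let d_xx x : A x -> d x x = 0. Proof. by case: Ad => + _ _ _; exact. Qed.
Let d_ge0 x y : A x -> A y -> 0 <= d x y.
Proof. by case: Ad => _ + _ _; exact. Qed.
Let d_sym x y : A x -> A y -> d x y = d y x.
Proof. by case: Ad => _ _ + _; exact. Qed.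
Let d_tri x y z : A x -> A y -> A z -> d x z <= d x y + d y z.
Proof. by case: Ad => _ _ _; exact. Qed.

Lemma hyperbolic_gp S p x y z : A p -> A x -> A y -> A z ->
  S <= gp p x y -> S <= gp p y z -> S - del <= gp p x z.
Proof.
move=> Ap Ax Ay Az h1 h2; apply: (le_trans _ (hyp Ax Ay Az Ap)).
by rewrite lerB// le_min h1.
Qed.

Lemma clocked_sub f phi s t u v : clocked_path A d f phi s t ->
  s <= u -> u <= v -> v <= t -> clocked_path A d f phi u v.
Proof.
move=> [st Af df ivt] su uv vt; split=> // [w uw wv|w w' uw ww' wv|w w' r uw ww' wv].
- by apply: Af; [exact: (le_trans su uw)|exact: (le_trans wv vt)].
- by apply: df => //; [exact: (le_trans su uw)|exact: (le_trans wv vt)].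
- by apply: ivt => //; [exact: (le_trans su uw)|exact: (le_trans wv vt)].
Qed.

Lemma clocked_le f phi s t : clocked_path A d f phi s t -> phi s <= phi t.
Proof.
move=> [st Af df _]; rewrite -subr_ge0.
by apply: (le_trans _ (df _ _ _ st _)) => //; apply: d_ge0; exact: Af.
Qed.

Lemma clocked_mid f phi s t : clocked_path A d f phi s t -> exists m,
  [/\ clocked_path A d f phi s m, clocked_path A d f phi m t,
      phi m - phi s = (phi t - phi s) / 2 & phi t - phi m = (phi t - phi s) / 2].
Proof.
move=> Hf; have := clocked_le Hf => le_phi; case: (Hf) => st Af df ivt.
have [||m [sm mt hm]] := ivt s t ((phi s + phi t) / 2) (lexx _) st (lexx _).
- lra.
- lra.
by exists m; split; [exact: clocked_sub Hf _ sm mt|exact: clocked_sub Hf sm mt _|lra|lra].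
Qed.

(** Bisecting a path of length 2 ^ m costs del at each of the m levels, so a path
    that keeps the distance S from w has, between its ends, a Gromov product
    at w below S by little more than del * m at most: in a hyperbolic space a
    detour around w is exponentially long. *)
Lemma gp_along_path (m : nat) S w : A w -> forall f phi s t,
  clocked_path A d f phi s t -> phi t - phi s <= 2 ^+ m ->
  (forall u, s <= u -> u <= t -> S <= d (f u) w) ->
  S - 1 / 2 - del * m%:R <= gp w (f s) (f t).
Proof.
move=> Aw; elim: m => [|m IH] f phi s t Hf hphi hS.
  case: (Hf) => st Af df _.
  have := hS s (lexx _) st; have := hS t st (lexx _).
  have := df s t (lexx _) st (lexx _); rewrite /gromov_product expr0 in hphi *.
  lra.
have [r [Hsr Hrt e1 e2]] := clocked_mid Hf.
case: (Hf) => st Af _ _; case: (Hsr) => sr _ _ _; case: (Hrt) => rt _ _ _.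
have -> : S - 1 / 2 - del * m.+1%:R = S - 1 / 2 - del * m%:R - del.
  by rewrite -natr1; lra.
move: hphi; rewrite exprS => hphi.
apply: (@hyperbolic_gp _ _ _ (f r)); rewrite ?Aw//; try exact: Af.
- apply: IH Hsr _ _; first lra.
  by move=> u su ur; apply: hS => //; exact: (le_trans _ rt).
- apply: IH Hrt _ _; first lra.
  by move=> u su ur; apply: hS => //; exact: (le_trans sr).
Qed.

(** This is connectedness of the path in the form that bisection yields: if P
    and Q cover it, a transition from P to Q happens within one unit of the
    clock. *)
Lemma clocked_switch (P Q : R -> Prop) f phi s t (m : nat) :
  clocked_path A d f phi s t -> phi t - phi s <= 2 ^+ m ->
  (forall u, s <= u -> u <= t -> P u \/ Q u) -> P s -> Q t ->
  exists u v, [/\ s <= u, u <= v, v <= t, P u /\ Q v & phi v - phi u <= 1].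
Proof.
elim: m s t => [|m IH] s t Hf hphi PQ Ps Qt.
  exists s, t; rewrite expr0 in hphi; split=> //; by case: Hf.
have [r [Hsr Hrt e1 e2]] := clocked_mid Hf.
case: (Hsr) => sr _ _ _; case: (Hrt) => rt _ _ _.
move: hphi; rewrite exprS => hphi.
have [Pr|Qr] := PQ r sr rt.
- have [||u [v [ru uv vt PQuv h]]] := IH _ _ Hrt _ _ Pr Qt; first lra.
    by move=> u ru ut; apply: PQ => //; exact: (le_trans sr).
  by exists u, v; split=> //; exact: (le_trans sr).
- have [||u [v [ru uv vt PQuv h]]] := IH _ _ Hsr _ _ Ps Qr; first lra.
    by move=> u ru ut; apply: PQ => //; exact: (le_trans _ rt).
  by exists u, v; split=> //; exact: (le_trans _ rt).
Qed.

Hypothesis lenA : length_metric_on A d.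

Lemma point_at_distance x y r e : A x -> A y -> 0 <= r -> r <= d x y -> 0 < e ->
  exists m, [/\ A m, d x m <= r & d m y <= d x y - r + e].
Proof.
move=> Ax Ay r0 rd e0.
have [f [phi [s [t [Hf fs ft hphi]]]]] := lenA Ax Ay e0.
case: (Hf) => st Af df ivt.
have dst := df _ _ (lexx _) st (lexx _); rewrite fs ft in dst.
have [||w [sw wt phiw]] := ivt s t (phi s + r) (lexx _) st (lexx _); first lra.
- lra.
exists (f w); split; first exact: Af.
- by have := df s w (lexx _) sw wt; rewrite fs; lra.
- by have := df w t sw wt (lexx _); rewrite ft; lra.
Qed.

(** Starting from p, one goes back towards the end x up to distance 2 * r, or to
    x itself if it is nearer, and then jumps to a nearby point q of the path,
    whose image is Q. The point p' is still almost on the way between x and y,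
    so it is r-close to the path, and the segment from p' to q stays, up to e,
    out of the ball of radius S around p; this is what the bound on the
    product at p expresses. *)
Lemma retreat K r e S (Q : X -> Prop) x y p : A x -> A y -> A p ->
  0 <= r -> S <= r -> 0 < e -> gp p x y + e <= K ->
  (forall q, A q -> gp q x y < K -> exists2 q', Q q' & A q' /\ d q q' <= r) ->
  (forall q', Q q' -> S <= d q' p) -> Q x ->
  exists p' q, [/\ A p', Q q /\ A q, d p p' + d p' x <= d p x + e, d p q <= 3 * r &
     S - e <= gp p p' q].
Proof.
move=> Ax Ay Ap r0 Sr e0 hK near far Qx.
have [le2r|lt2r] := leP (d p x) (2 * r).
  exists x, x; split => //; first by rewrite d_xx//; lra.
    lra.
  have := far x Qx; rewrite /gromov_product d_xx//; lra.
have [||p' [Ap' h1 h2]] := @point_at_distance p x (2 * r) e Ap Ax _ _ e0; try lra.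
have [|q Qq [Aq h3]] := near p' Ap'.
  apply: lt_le_trans hK; rewrite /gromov_product.
  have := d_tri Ay Ap Ap'; rewrite [d x p']d_sym// [d x p]d_sym//.
  lra.
exists p', q; split=> //; first lra.
  by have := d_tri Ap Ap' Aq; lra.
have := far q Qq; have := d_tri Ap Ap' Ax; rewrite /gromov_product.
rewrite [d p' p]d_sym//; lra.
Qed.

Lemma gpC p x y : A x -> A y -> gp p x y = gp p y x.
Proof. by move=> Ax Ay; rewrite /gromov_product [d x y]d_sym//; lra. Qed.

(** The core of the stability of quasigeodesics. If p were farther than r - 1/2
    from the path, retreating from p to both sides and following the path
    between the two nearby points u1 and u2 would give a detour around p. Its
    clock length is linear in r, hence by the logarithmic estimate the product
    at p of the two retreat points is at least about r - del * log r; but that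
    product is at most the product of the ends, which is less than K. *)
Lemma shrink_neighborhood lam mu K r (m : nat) f phi s t :
  clocked_path A d f phi s t ->
  (forall u v, s <= u -> u <= v -> v <= t ->
     phi v - phi u <= lam * d (f u) (f v) + mu) ->
  0 <= lam -> 0 <= K -> 2 * K + 3 + 4 * del <= r ->
  6 * lam * r + mu <= 2 ^+ m -> del * m%:R <= r / 4 ->
  (forall p, A p -> gp p (f s) (f t) < K ->
     exists u, [/\ s <= u, u <= t & d p (f u) <= r]) ->
  forall p, A p -> gp p (f s) (f t) < K ->
     exists u, [/\ s <= u, u <= t & d p (f u) <= r - 1 / 2].
Proof.
move=> Hf qg lam0 K0 hr hm1 hm2 near p Ap gpK; apply: contrapT => far.
case: (Hf) => st Af _ _.
have {}far u : s <= u -> u <= t -> r - 1 / 2 <= d (f u) p.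
  move=> su ut; rewrite d_sym//; last exact: Af.
  by rewrite leNgt; apply/negP => lt; apply: far; exists u; split=> //; exact: ltW.
pose Q q := exists u, [/\ s <= u, u <= t & q = f u].
(* The slack e keeps the retreat points below K. *)
pose e := Num.min (1 / 2) (K - gp p (f s) (f t)).
have e0 : 0 < e by rewrite lt_min; apply/andP; split; lra.
have e_half : e <= 1 / 2 by rewrite ge_min lexx.
have eK : gp p (f s) (f t) + e <= K.
  by rewrite addrC -lerBrDr ge_min lexx orbT.
have r0 : 0 <= r by have := del0; have := K0; lra.
have As := Af s (lexx _) st; have At := Af t st (lexx _).
have nearQ q : A q -> gp q (f s) (f t) < K -> exists2 q', Q q' & A q' /\ d q q' <= r.
  move=> Aq /(near q Aq)[u [su ut h]].
  by exists (f u); [exists u|split=> //; exact: Af].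
have farQ q : Q q -> r - 1 / 2 <= d q p by move=> [u [su ut ->]]; exact: far.
have [||p1 [_ [Ap1 [[u1 [su1 ut1 ->]] Aq1] h1 k1 g1]]] := @retreat K r e (r - 1 / 2) Q
  (f s) (f t) p As At Ap r0 _ e0 eK nearQ farQ _; first lra.
  by exists s.
have eK' : gp p (f t) (f s) + e <= K by rewrite gpC.
have [|q Aq||p2 [_ [Ap2 [[u2 [su2 ut2 ->]] Aq2] h2 k2 g2]]] := @retreat K r e (r - 1 / 2) Q
  (f t) (f s) p At As Ap r0 _ e0 eK' _ farQ _; first lra.
  by rewrite gpC//; exact: nearQ.
  by exists t.
have q12 : d (f u1) (f u2) <= 6 * r.
  by have := d_tri Aq1 Ap Aq2; rewrite [d _ p]d_sym//; lra.
have g12 : r - 1 / 2 - 1 / 2 - del * m%:R <= gp p (f u1) (f u2).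
  have [le12|lt21] := leP u1 u2.
    apply: gp_along_path (clocked_sub Hf su1 le12 ut2) _ _ => //.
      apply: le_trans hm1; apply: le_trans (qg _ _ su1 le12 ut2) _.
      by rewrite lerD2r [6 * lam]mulrC -mulrA ler_wpM2l.
    move=> u u1u uu2; apply: far; [exact: (le_trans su1)|exact: le_trans ut2].
  rewrite gpC//; apply: gp_along_path (clocked_sub Hf su2 (ltW lt21) ut1) _ _ => //.
    apply: le_trans hm1; apply: le_trans (qg _ _ su2 (ltW lt21) ut1) _.
    by rewrite [d _ _]d_sym// lerD2r [6 * lam]mulrC -mulrA ler_wpM2l.
  move=> u u2u uu1; apply: far; [exact: (le_trans su2)|exact: le_trans ut1].
have dm0 : 0 <= del * m%:R by rewrite mulr_ge0.
have g13 : r - 1 - del * m%:R - del <= gp p p1 (f u2).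
  by apply: hyperbolic_gp Ap Ap1 Aq1 Aq2 _ _; lra.
have g14 : r - 1 - del * m%:R - del - del <= gp p p1 p2.
  apply: (hyperbolic_gp Ap Ap1 Aq2 Ap2 g13 _).
  by rewrite (gpC _ Aq2 Ap2); have := del0; lra.
have : gp p p1 p2 <= K.
  have := d_tri As Ap1 At; have := d_tri Ap1 Ap2 At; move: h1 h2 eK.
  rewrite /gromov_product [d (f s) p1]d_sym// [d p1 p]d_sym// [d p2 p]d_sym//.
  by rewrite [d (f s) p]d_sym// [d (f t) p]d_sym//; lra.
have := del0; lra.
Qed.

(** All points with product less than K are within some distance of the path,
    since they are boundedly far from its start; shrinking this distance by 1/2
    as long as it exceeds M yields a bound that depends on the constants only. *)
Lemma near_quasigeodesic lam mu K M f phi s t :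
  clocked_path A d f phi s t ->
  (forall u v, s <= u -> u <= v -> v <= t ->
     phi v - phi u <= lam * d (f u) (f v) + mu) ->
  0 <= lam -> 0 <= K -> 2 * K + 3 + 4 * del <= M ->
  (forall r, M <= r ->
     exists2 m : nat, 6 * lam * r + mu <= 2 ^+ m & del * m%:R <= r / 4) ->
  forall p, A p -> gp p (f s) (f t) < K ->
     exists u, [/\ s <= u, u <= t & d p (f u) <= M].
Proof.
move=> Hf qg lam0 K0 hM hlog.
case: (Hf) => st Af _ _.
have As := Af s (lexx _) st; have At := Af t st (lexx _).
suff H (n : nat) : (forall p, A p -> gp p (f s) (f t) < K ->
     exists u, [/\ s <= u, u <= t & d p (f u) <= M + n%:R / 2]) ->
   forall p, A p -> gp p (f s) (f t) < K ->
     exists u, [/\ s <= u, u <= t & d p (f u) <= M].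
  (* The start f s is within d (f s) (f t) + 2 * K of every such p. *)
  apply: (H (Num.truncn (2 * (d (f s) (f t) + 2 * K))).+1) => p Ap gpK.
  exists s; split=> //.
  have := truncnS_gt (2 * (d (f s) (f t) + 2 * K)).
  set n := _%:R => hn.
  have := del0; have := d_ge0 At Ap; move: gpK; rewrite /gromov_product [d p (f s)]d_sym//; lra.
elim: n => [|n IH] near; first by move=> p Ap /(near p Ap); rewrite mul0r addr0.
apply: IH => p Ap gpK.
have [|m h1 h2] := hlog (M + n.+1%:R / 2); first by rewrite lerDl divr_ge0.
have -> : M + n%:R / 2 = M + n.+1%:R / 2 - 1 / 2 by rewrite -natr1; lra.
apply: (shrink_neighborhood Hf qg lam0 K0 _ h1 h2 near Ap gpK).
by apply: (le_trans hM); rewrite lerDl divr_ge0.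
Qed.

(** The converse direction of stability. Every point of an almost shortest path
    from f s to f t is M-close to f, either before or after the time u; where
    the two alternatives meet, f has two points v1 <= u <= v2 at distance at
    most 2 * M + 1, and the neargeodesic property makes the arc between them
    short. *)
Lemma neargeodesic_near_thin_point c0 M f phi s t :
  clocked_path A d f phi s t ->
  (forall u v, s <= u -> u <= v -> v <= t ->
     phi v - phi u <= c0 * d (f u) (f v)) ->
  0 <= c0 ->
  (forall p, A p -> gp p (f s) (f t) < 1 ->
     exists u, [/\ s <= u, u <= t & d p (f u) <= M]) ->
  forall u, s <= u -> u <= t ->
  exists p, [/\ A p, gp p (f s) (f t) < 1 & d (f u) p <= c0 * (2 * M + 1) + M].
Proof.
move=> Hf qg c00 near u su ut.
case: (Hf) => st Af df _.
have As := Af s (lexx _) st; have At := Af t st (lexx _).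
have [f' [phi' [s' [t' [Hf' fs' ft' hphi']]]]] := lenA As At (@ltr01 R).
case: (Hf') => st' Af' df' _.
have gpf' w : s' <= w -> w <= t' -> gp (f' w) (f s) (f t) <= 1 / 2.
  move=> sw wt; have := df' s' w (lexx _) sw wt; have := df' w t' sw wt (lexx _).
  rewrite fs' ft' /gromov_product => h1 h2.
  by rewrite [d (f t) _]d_sym//; [lra|exact: Af'].
pose P w := exists v, [/\ s <= v, v <= u & d (f' w) (f v) <= M].
pose Q w := exists v, [/\ u <= v, v <= t & d (f' w) (f v) <= M].
have PQ w : s' <= w -> w <= t' -> P w \/ Q w.
  move=> sw wt.
  have [|v [sv vt h]] := near (f' w) (Af' w sw wt); first by have := gpf' w sw wt; lra.
  have [vu|uv] := leP v u; [by left; exists v|right; exists v; split=> //; exact: ltW].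
have [m hm] : exists m : nat, phi' t' - phi' s' <= 2 ^+ m.
  have [m0 hm0] := linear_below_exp2 0 (phi' t' - phi' s').
  by exists m0; have := hm0 m0 (leqnn _); rewrite mul0r add0r.
have M0 : 0 <= M.
  have [|v [sv vt]] := near (f s) As; last by apply/le_trans/d_ge0 => //; exact: Af.
  by rewrite /gromov_product d_xx// [d _ (f s)]d_sym//; lra.
have Ps' : P s' by exists s; split=> //; rewrite fs' d_xx.
have Qt' : Q t' by exists t; split=> //; rewrite ft' d_xx.
have [w1 [w2 [sw1 w12 wt2 [[v1 [sv1 v1u h1]] [v2 [uv2 vt2 h2]]] hw]]] :=
  clocked_switch Hf' hm PQ Ps' Qt'.
have Aw1 := Af' w1 sw1 (le_trans w12 wt2).
have Aw2 := Af' w2 (le_trans sw1 w12) wt2.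
have Av1 := Af v1 sv1 (le_trans v1u ut).
have Av2 := Af v2 (le_trans su uv2) vt2.
have Au := Af u su ut.
exists (f' w1); split=> //.
  by have := gpf' w1 sw1 (le_trans w12 wt2); lra.
have e1 := df' _ _ sw1 w12 wt2.
have e2 := d_tri Av1 Aw1 Av2; have e3 := d_tri Aw1 Aw2 Av2.
rewrite [d (f v1) (f' w1)]d_sym// in e2.
have e4 := qg _ _ sv1 (le_trans v1u uv2) vt2.
have e5 := df _ _ sv1 v1u ut.
have e6 := df _ _ su uv2 vt2.
have e7 := d_ge0 Au Av2.
have e8 := d_tri Au Av1 Aw1.
rewrite [d (f v1) (f' w1)]d_sym// [d (f u) (f v1)]d_sym// in e8.
have : c0 * d (f v1) (f v2) <= c0 * (2 * M + 1) by rewrite ler_wpM2l//; lra.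
lra.
Qed.

End hyperbolic.

(** * One-Lipschitz functions with short doubling pieces *)

Section one_lipschitz.
Context {R : realType} (q : R -> R).
Hypothesis q_lip : forall u v, q v <= q u + `|v - u|.

Lemma one_lipschitz_continuous : continuous q.
Proof.
move=> x; apply/cvgrPdist_le => e e0; near=> y.
have xy : `|x - y| <= e by near: y; apply: cvgr_dist_le.
have := q_lip x y; have := q_lip y x; rewrite [`|y - x|]distrC ler_norml; lra.
Unshelve. all: by end_near. Qed.

(** The time v is the infimum of the times at which q is at least r; the
    Lipschitz bound forces q v = r. *)
Lemma first_hitting_time a b r : a <= b -> q a <= r -> r <= q b ->
  exists v, [/\ a <= v, v <= b, q v = r & forall w, a <= w -> w <= v -> q w <= r].
Proof.
move=> ab qa qb.
pose S := [set w | [/\ a <= w, w <= b & r <= q w]].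
have Sb : S b by [].
have lbS : has_lbound S by exists a => w [].
have infS : has_inf S by split=> //; exists b.
have before w : a <= w -> w < inf S -> q w < r.
  move=> aw wi; rewrite ltNge; apply/negP => rw.
  have wb : w <= b by apply: (le_trans (ltW wi)); exact: ge_inf.
  have : inf S <= w by apply: ge_inf.
  by rewrite leNgt wi.
have ai : a <= inf S by apply: lb_le_inf => [|w []//]; exists b.
have ib : inf S <= b by exact: ge_inf.
have qi : q (inf S) = r.
  apply/eqP; rewrite eq_le; apply/andP; split; rewrite leNgt; apply/negP => lt.
    have ai' : a < inf S.
      by rewrite lt_neqAle ai andbT; apply/negP => /eqP e; move: lt; rewrite -e ltNge qa.
    pose w := Num.max a (inf S - (q (inf S) - r) / 2).
    have wi : w < inf S by rewrite gt_max ai' /=; lra.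
    have aw : a <= w by rewrite le_max lexx.
    have := before w aw wi; have := q_lip w (inf S).
    have : inf S - (q (inf S) - r) / 2 <= w by rewrite le_max lexx orbT.
    rewrite ger0_norm ?subr_ge0 ?(ltW wi)//; lra.
  have e0 : 0 < (r - q (inf S)) / 2 by lra.
  have [w [aw wb rw] wi] := inf_adherent e0 infS.
  have iw : inf S <= w by exact: ge_inf.
  by have := q_lip (inf S) w; rewrite ger0_norm ?subr_ge0//; lra.
exists (inf S); split=> // w aw; rewrite le_eqVlt => /orP[/eqP->|/(before w aw)/ltW//].
by rewrite qi.
Qed.

Context (q_gt0 : forall u, 0 < q u) (N T : R) (N1 : 1 <= N).
Hypothesis doubling_piece : forall u v, 0 <= u -> u <= v -> v <= T ->
  (forall w, u <= w -> w <= v -> q w <= 2 * q u /\ q w <= 2 * q v) ->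
  v - u <= N * q u /\ forall w, u <= w -> w <= v -> q u <= N * q w.

(** Induction on the number of times q has doubled since 0: the first time v at
    which q reaches half of the record value q u is itself a record, and the
    arc from v to u is a doubling piece, of length at most N * q v. *)
Lemma record_bound u : 0 <= u -> u <= T ->
  (forall w, 0 <= w -> w <= u -> q w <= q u) -> u <= 2 * N * q u.
Proof.
have N1' := N1; have [m hm] : exists m : nat, q u <= 2 ^+ m * q 0.
  exists (Num.truncn (q u / q 0)).+1; rewrite -ler_pdivrMr//.
  apply/ltW/(lt_le_trans (truncnS_gt _)); rewrite -natrX ler_nat.
  exact/ltnW/ltn_expl.
elim: m u hm => [|m IH] u hm u0 uT rec.
  have [|h _] := doubling_piece (lexx 0) u0 uT.
    move=> w w0 wu; have := rec w w0 wu; have := q_gt0 w.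
    by rewrite expr0 in hm; have := rec 0 (lexx _) u0; lra.
  have : N * q 0 <= N * q u by rewrite ler_pM2l; [exact: rec|lra].
  have : 0 <= N * q u by rewrite mulr_ge0 ?(ltW (q_gt0 _))//; lra.
  lra.
have qu := q_gt0 u.
have [small|big] := leP (q u) (2 * q 0).
  have [|h _] := doubling_piece (lexx 0) u0 uT.
    by move=> w w0 wu; have := rec w w0 wu; have := rec 0 (lexx _) u0; lra.
  have : N * q 0 <= N * q u by rewrite ler_pM2l; [exact: rec|lra].
  have : 0 <= N * q u by rewrite mulr_ge0 ?(ltW (q_gt0 _))//; lra.
  lra.
have [||v [v0 vu qv vrec]] := @first_hitting_time 0 u (q u / 2) u0; try lra.
have hv : v <= 2 * N * q v.
  apply: IH => //; [|exact: le_trans uT|].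
    by rewrite qv; move: hm; rewrite exprS; lra.
  by move=> w w0 wv; rewrite qv; exact: vrec.
have [|h _] := doubling_piece v0 vu uT.
  by move=> w vw wu; have := rec w (le_trans v0 vw) wu; rewrite qv; lra.
have : 0 <= N * q u by rewrite mulr_ge0 ?(ltW (q_gt0 _))//; lra.
rewrite qv in hv h; lra.
Qed.

(** The time t lies on a doubling piece between a time v at which q is
    maximal on [0, t] and the next time w after t at which q regains the value
    q v; such w exists because q is maximal at T. *)
Lemma carrot_up_to_max : (forall w, 0 <= w -> w <= T -> q w <= q T) ->
  forall t, 0 <= t -> t <= T -> t <= 3 * N ^+ 2 * q t.
Proof.
move=> qmax t t0 tT; have N1' := N1.
have [v] := EVT_max t0 (continuous_subspaceT one_lipschitz_continuous).
rewrite in_itv /= => /andP[v0 vt] vmax.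
have {}vmax w : 0 <= w -> w <= t -> q w <= q v.
  by move=> w0 wt; apply: vmax; rewrite in_itv/= w0.
have [||w [tw wT qw wrec]] := @first_hitting_time t T (q v) tT.
- exact: vmax.
- by apply: qmax => //; exact: le_trans tT.
have hv : v <= 2 * N * q v.
  apply: record_bound => //; first exact: le_trans tT.
  by move=> x x0 xv; apply: vmax => //; exact: le_trans vt.
have [|h1 h2] := doubling_piece v0 (le_trans vt tw) wT.
  move=> x vx xw; rewrite qw; have := q_gt0 v.
  have : q x <= q v; last lra.
  have [xt|tx] := leP x t; first by apply: vmax => //; exact: le_trans vx.
  by apply: wrec => //; exact: ltW.
have := h2 t vt tw; have := q_gt0 t; rewrite expr2; nra.
Qed.

End one_lipschitz.

(** * Neargeodesics in the presence of cone arcs *)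

Lemma stability_constant {R : realType} (del lam mu K : R) :
  0 <= del -> 0 <= lam -> 0 <= mu ->
  exists2 M, 2 * K + 3 + 4 * del <= M & forall r, M <= r ->
    exists2 m : nat, 6 * lam * r + mu <= 2 ^+ m & del * m%:R <= r / 4.
Proof.
move=> del0 lam0 mu0.
have [|M hM] := @log_beats_linear R del (6 * lam) mu del0 _ mu0.
  by rewrite mulr_ge0.
exists (Num.max M (2 * K + 3 + 4 * del)); first by rewrite le_max lexx orbT.
by move=> r; rewrite ge_max => /andP[/hM].
Qed.

(** The properties of half a cone arc, parametrized by arc length, in terms
    of the metric d and the boundary distance rad: both are comparable with the
    elapsed length counted from rad x. *)
Definition john_ray {R : realType} {X : Type} (A : set X) (d : X -> X -> R)
    (rad : X -> R) (C : R) (x m : X) (f : R -> X) (T : R) :=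
  [/\ 0 <= T, f 0 = x, f T = m,
      forall s, 0 <= s -> s <= T ->
        [/\ A (f s), rad x + s <= C * rad (f s) & rad (f s) <= rad x + s] &
      forall s t, 0 <= s -> s <= t -> t <= T ->
        d (f s) (f t) <= C * (ln (rad x + t) - ln (rad x + s))].

Section rays.
Context {R : realType} {X : Type} {A : set X} {d : X -> X -> R} {rad : X -> R}.
Context {C : R}.
Hypothesis C1 : 1 <= C.
Hypothesis rad_gt0 : forall x, A x -> 0 < rad x.
Hypothesis rad_exp : forall x y, A x -> A y -> rad y <= rad x * expR (d x y).

Lemma john_ray_start x m f T : john_ray A d rad C x m f T -> 0 < rad x.
Proof.
by move=> [T0 <- _ Af _]; apply: rad_gt0; have [] := Af 0 (lexx _) T0.
Qed.

Lemma john_ray_clocked x m f T : john_ray A d rad C x m f T ->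
  clocked_path A d f (fun s => C * ln (rad x + s)) 0 T.
Proof.
move=> H; have Dx := john_ray_start H; case: H => T0 f0 fT Af df.
have C0 : 0 < C by have := C1; lra.
split=> //.
- by move=> u u0 uT; have [] := Af u u0 uT.
- by move=> u v u0 uv vT; rewrite -mulrBr; exact: df.
move=> u v r u0 uv vT hu hv.
have pu : 0 < rad x + u by lra.
have pv : 0 < rad x + v by lra.
exists (expR (r / C) - rad x); split.
- rewrite lerBrDl -[leLHS]lnK ?posrE// ler_expR ler_pdivlMr//.
  by rewrite mulrC.
- rewrite lerBlDl -[leRHS]lnK ?posrE// ler_expR ler_pdivrMr//.
  by rewrite mulrC.
- by rewrite addrC subrK expRK mulrC divfK// gt_eqF.
Qed.

(** Along the ray rad is comparable to rad x + s, and the logarithm of rad is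
    1-Lipschitz for d. *)
Lemma john_ray_quasigeodesic x m f T : john_ray A d rad C x m f T ->
  forall u v, 0 <= u -> u <= v -> v <= T ->
  C * ln (rad x + v) - C * ln (rad x + u) <= C * d (f u) (f v) + C * ln C.
Proof.
move=> H; have Dx := john_ray_start H; case: H => T0 f0 fT Af df u v u0 uv vT.
have C0 : 0 < C by have := C1; lra.
have [Au _ hu] := Af u u0 (le_trans uv vT).
have [Av hv _] := Af v (le_trans u0 uv) vT.
have pu : 0 < rad x + u by lra.
have pv : 0 < rad x + v by lra.
rewrite -mulrBr -mulrDr ler_pM2l// lerBlDl.
rewrite -[d _ _]expRK -lnM ?posrE ?expR_gt0// -lnM ?posrE ?mulr_gt0 ?expR_gt0//.
rewrite ler_ln ?posrE ?mulr_gt0 ?expR_gt0//.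
apply: (le_trans hv).
have h1 : rad (f v) <= (rad x + u) * expR (d (f u) (f v)).
  by apply: (le_trans (rad_exp Au Av)); rewrite ler_pM2r ?expR_gt0.
have : C * rad (f v) <= C * ((rad x + u) * expR (d (f u) (f v))) by rewrite ler_pM2l.
lra.
Qed.

(** Closeness of z to f s bounds rad (f s) by a multiple of rad z, hence of
    rad x. As the elapsed length is at most a multiple of rad (f s), the point f s
    cannot be far along the ray. *)
Lemma john_ray_close M x m f T s z : john_ray A d rad C x m f T -> A z ->
  metric_on A d ->
  0 <= s -> s <= T -> d z (f s) <= M -> rad z <= 2 * rad x ->
  d z x <= M + C * ln (2 * C * expR M).
Proof.
move=> H Az [_ _ d_sym d_tri] s0 sT zs Dz.
have Dx := john_ray_start H; case: H => T0 f0 fT Af df.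
have C0 : 0 < C by have := C1; lra.
have [As hs _] := Af s s0 sT.
have Ax : A x by have [] := Af 0 (lexx _) T0; rewrite f0.
apply: le_trans (d_tri _ _ _ Az As Ax) _; apply: lerD => //.
rewrite d_sym//; have := df 0 s (lexx _) s0 sT; rewrite f0 addr0 => h.
apply: (le_trans h); rewrite ler_pM2l// lerBlDr -lnM ?posrE ?mulr_gt0 ?expR_gt0//.
rewrite ler_ln ?posrE ?mulr_gt0 ?expR_gt0//; last lra.
apply: (le_trans hs).
have h2 : rad (f s) <= rad z * expR M.
  apply: (le_trans (rad_exp Az As)); rewrite ler_pM2l ?ler_expR//; exact: rad_gt0.
have h3 : rad z * expR M <= 2 * rad x * expR M by rewrite ler_pM2r ?expR_gt0.
have : C * rad (f s) <= C * (2 * rad x * expR M) by rewrite ler_pM2l//; lra.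
lra.
Qed.

End rays.

(** By hyperbolicity, a point p with small product of the two ends has a
    small product of m with one of the ends, so it is close to one of the two
    rays. On a doubling piece this makes every point close to one of the ends,
    and by clocked_switch both cases occur near one place. *)
Lemma doubling_piece_length {R : realType} (C c0 del : R) :
  1 <= C -> 0 <= c0 -> 0 <= del -> exists N : R,
  forall (X : Type) (A : set X) (d : X -> X -> R) (rad : X -> R),
  metric_on A d -> gromov_hyperbolic A d del -> length_metric_on A d ->
  (forall x, A x -> 0 < rad x) ->
  (forall x y, A x -> A y -> rad y <= rad x * expR (d x y)) ->
  (forall x y, A x -> A y -> exists m f1 T1 f2 T2,
     john_ray A d rad C x m f1 T1 /\ john_ray A d rad C y m f2 T2) ->
  forall f phi s t, clocked_path A d f phi s t ->
  (forall u v, s <= u -> u <= v -> v <= t ->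
     phi v - phi u <= c0 * d (f u) (f v)) ->
  (forall u, s <= u -> u <= t -> rad (f u) <= 2 * rad (f s) /\ rad (f u) <= 2 * rad (f t)) ->
  phi t - phi s <= N.
Proof.
move=> C1 c00 del0.
have C0 : 0 <= C by lra.
have ClnC0 : 0 <= C * ln C by rewrite mulr_ge0// ln_ge0.
have [M1 M1K M1log] := stability_constant 1 del0 c00 (lexx 0).
have [M2 M2K M2log] := stability_constant (1 + del) del0 C0 ClnC0.
(* M bounds the distance to a ray, N the distance to one of the ends. *)
pose M := c0 * (2 * M1 + 1) + M1 + M2.
pose N := M + C * ln (2 * C * expR M).
exists (c0 * (2 * N + 1)) => X A d rad Ad hyp lenA rad_gt0 rad_exp rays f phi s t Hf qg dbl.
case: (Hf) => st Af df _; case: (Ad) => d_xx d_ge0 d_sym d_tri.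
have As := Af s (lexx _) st; have At := Af t st (lexx _).
have [m [f1 [T1 [f2 [T2 [ray1 ray2]]]]]] := rays _ _ As At.
have nearf p : A p -> gromov_product d p (f s) (f t) < 1 ->
    exists u, [/\ s <= u, u <= t & d p (f u) <= M1].
  have qg0 u v : s <= u -> u <= v -> v <= t ->
      phi v - phi u <= c0 * d (f u) (f v) + 0 by rewrite addr0; exact: qg.
  exact: (near_quasigeodesic Ad del0 hyp lenA Hf qg0 c00 ler01).
have near_ray x f' T p : john_ray A d rad C x m f' T -> A p ->
    gromov_product d p x m < 1 + del ->
    exists u, [/\ 0 <= u, u <= T & d p (f' u) <= M2].
  move=> ray Ap h; have K0 : 0 <= 1 + del by lra.
  apply: (near_quasigeodesic Ad del0 hyp lenA (john_ray_clocked C1 rad_gt0 ray)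
    (john_ray_quasigeodesic C1 rad_gt0 rad_exp ray) C0 K0) => //.
  by case: ray => _ -> -> _ _.
have near_end u : s <= u -> u <= t -> d (f u) (f s) <= N \/ d (f u) (f t) <= N.
  move=> su ut; have Au := Af u su ut.
  have [p [Ap gpp dp]] := neargeodesic_near_thin_point Ad lenA Hf qg c00 nearf su ut.
  have [Ds Dt] := dbl u su ut.
  have Am : A m.
    by case: ray1 => T10 _ <- /(_ T1 T10 (lexx _))[].
  have : gromov_product d p (f s) m < 1 + del \/ gromov_product d p (f t) m < 1 + del.
    have [|h1] := ltP (gromov_product d p (f s) m) (1 + del); first by left.
    have [|h2] := ltP (gromov_product d p (f t) m) (1 + del); first by right.
    rewrite (gpC Ad)// in h2.
    have := hyperbolic_gp hyp Ap As Am At h1 h2; lra.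
  move=> [h|h]; [left|right].
    have [w [w0 wT hw]] := near_ray _ _ _ _ ray1 Ap h.
    have [Aw _ _] : [/\ A (f1 w), rad (f s) + w <= C * rad (f1 w) & rad (f1 w) <= rad (f s) + w].
      by case: ray1 => _ _ _ + _; exact.
    apply: (john_ray_close C1 rad_gt0 rad_exp ray1 Au Ad w0 wT) => //.
    by apply: le_trans (d_tri _ _ _ Au Ap Aw) _; rewrite lerD.
  have [w [w0 wT hw]] := near_ray _ _ _ _ ray2 Ap h.
  have [Aw _ _] : [/\ A (f2 w), rad (f t) + w <= C * rad (f2 w) & rad (f2 w) <= rad (f t) + w].
    by case: ray2 => _ _ _ + _; exact.
  apply: (john_ray_close C1 rad_gt0 rad_exp ray2 Au Ad w0 wT) => //.
  by apply: le_trans (d_tri _ _ _ Au Ap Aw) _; rewrite lerD.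
have M10 : 0 <= M1 by lra.
have M20 : 0 <= M2 by lra.
have M0 : 0 <= M by rewrite !addr_ge0// mulr_ge0//; lra.
have N0 : 0 <= N.
  rewrite addr_ge0// mulr_ge0// ln_ge0//.
  have : 1 <= expR M by rewrite -expR0 ler_expR.
  nra.
have [n hn] : exists n : nat, phi t - phi s <= 2 ^+ n.
  have [n hn] := linear_below_exp2 0 (phi t - phi s).
  by exists n; have := hn n (leqnn _); rewrite mul0r add0r.
have [||u [v [su uv vt [hu hv] huv]]] := clocked_switch Ad Hf hn near_end.
- by rewrite d_xx.
- by rewrite d_xx.
apply: (le_trans (qg _ _ (lexx _) st (lexx _))); apply: ler_wpM2l => //.
have Au := Af u su (le_trans uv vt); have Av := Af v (le_trans su uv) vt.
have := df _ _ su uv vt; have := d_tri _ _ _ As Au At; have := d_tri _ _ _ Au Av At.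
rewrite [d (f s) (f u)]d_sym//; lra.
Qed.

(** The bounded clock length of doubling pieces gives, through the exponential
    control of rad and the length estimate, the hypothesis of
    carrot_up_to_max with a constant depending on C, c0 and del only. *)
Lemma neargeodesic_carrot {R : realType} (C c0 del : R) :
  1 <= C -> 0 <= c0 -> 0 <= del -> exists2 B : R, 1 <= B &
  forall (X : Type) (A : set X) (d : X -> X -> R) (rad : X -> R),
  metric_on A d -> gromov_hyperbolic A d del -> length_metric_on A d ->
  (forall x, A x -> 0 < rad x) ->
  (forall x y, A x -> A y -> rad y <= rad x * expR (d x y)) ->
  (forall x y, A x -> A y -> exists m f1 T1 f2 T2,
     john_ray A d rad C x m f1 T1 /\ john_ray A d rad C y m f2 T2) ->
  forall h phi L, clocked_path A d h phi 0 L ->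
  (forall u v, 0 <= u -> u <= v -> v <= L ->
     phi v - phi u <= c0 * d (h u) (h v)) ->
  (forall u, A (h u)) ->
  (forall u v, rad (h v) <= rad (h u) + `|v - u|) ->
  (forall u v r, 0 <= u -> u <= v -> v <= L ->
     (forall w, u <= w -> w <= v -> rad (h w) <= r) -> v - u <= r * (phi v - phi u)) ->
  forall t, 0 <= t -> t <= L -> t <= B * rad (h t) \/ L - t <= B * rad (h t).
Proof.
move=> C1 c00 del0; have [N0 hN0] := doubling_piece_length C1 c00 del0.
pose N := Num.max (2 * N0) (Num.max (expR N0) 1).
have N2 : 2 * N0 <= N by rewrite le_max lexx.
have NE : expR N0 <= N by rewrite !le_max lexx orbT.
have N1 : 1 <= N by rewrite !le_max lexx !orbT.
exists (3 * N ^+ 2); first by rewrite expr2; nra.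
move=> X A d rad Ad hyp lenA rad_gt0 rad_exp rays h phi L Hh qg Ah hlip hlen t t0 tL.
have {}hN0 := hN0 X A d rad Ad hyp lenA rad_gt0 rad_exp rays.
pose q u := rad (h u).
have q0 u : 0 < q u by exact: rad_gt0.
case: (Hh) => L0 _ dh _; case: (Ad) => _ d_ge0 d_sym _.
have piece u v : 0 <= u -> u <= v -> v <= L ->
    (forall w, u <= w -> w <= v -> q w <= 2 * q u /\ q w <= 2 * q v) ->
    (v - u <= N * q u /\ v - u <= N * q v) /\
    forall w, u <= w -> w <= v -> q u <= N * q w /\ q v <= N * q w.
  move=> u0 uv vL dbl.
  have Huv := clocked_sub Hh u0 uv vL.
  have phiN : phi v - phi u <= N0.
    apply: hN0 Huv _ dbl => a b ua ab bv.
    by apply: qg => //; [exact: le_trans ua|exact: le_trans vL].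
  have short x : (forall w, u <= w -> w <= v -> q w <= 2 * q x) -> v - u <= N * q x.
    move=> hx; apply: (le_trans (hlen _ _ _ u0 uv vL hx)).
    rewrite [2 * _]mulrC -mulrA mulrC ler_pM2r//; lra.
  split; first by split; apply: short => w uw wv; have [] := dbl w uw wv.
  have comp x w : u <= x -> x <= v -> u <= w -> w <= v -> q x <= N * q w.
    move=> ux xv uw wv.
    apply: (le_trans (rad_exp _ _ (Ah w) (Ah x))); rewrite mulrC (ler_pM2r (q0 w)).
    apply: (le_trans _ NE); rewrite ler_expR; apply: le_trans phiN.
    have [wx|xw] := leP w x.
      have := dh _ _ u0 uw (le_trans wv vL).
      have := dh _ _ (le_trans u0 uw) wx (le_trans xv vL).
      have := dh _ _ (le_trans u0 ux) xv vL.
      have := d_ge0 _ _ (Ah u) (Ah w); have := d_ge0 _ _ (Ah x) (Ah v); lra.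
    rewrite d_sym//; have := dh _ _ u0 ux (le_trans xv vL).
    have := dh _ _ (le_trans u0 ux) (ltW xw) (le_trans wv vL).
    have := dh _ _ (le_trans u0 uw) wv vL.
    have := d_ge0 _ _ (Ah u) (Ah x); have := d_ge0 _ _ (Ah w) (Ah v); lra.
  move=> w uw wv; have uv' := le_trans uw wv.
  by split; apply: comp.
have [T] := EVT_max L0 (continuous_subspaceT (one_lipschitz_continuous hlip)).
rewrite in_itv/= => /andP[T0 TL] Tmax.
have {}Tmax w : 0 <= w -> w <= L -> q w <= q T.
  by move=> w0 wL; apply: Tmax; rewrite in_itv/= w0.
have [tT|/ltW Tt] := leP t T; [left|right].
  apply: (@carrot_up_to_max _ q hlip q0 N T N1 _ _ t t0 tT) => [u v u0 uv vT dbl|w w0 wT].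
    have [[? _] ?] := piece _ _ u0 uv (le_trans vT TL) dbl.
    by split=> // w uw wv; have [] : q u <= N * q w /\ q v <= N * q w by auto.
  by apply: Tmax => //; exact: le_trans TL.
(* Beyond the maximum, reverse the curve. *)
pose q' u := q (L - u).
have -> : rad (h t) = q' (L - t) by rewrite /q' opprB addrC subrK.
apply: (@carrot_up_to_max _ q' _ _ N (L - T) N1); rewrite ?subr_ge0 ?lerB//.
- move=> u v; have -> : `|v - u| = `|(L - v) - (L - u)|.
    by rewrite -normrN; congr (`|_|); lra.
  exact: hlip.
- by move=> u; exact: q0.
- move=> u v u0 uv vT dbl.
  have [|||x vx xu|[_ h1] h2] := piece (L - v) (L - u) _ _ _ _; try lra.
    have [] := dbl (L - x) _ _; try lra.
    by rewrite /q' opprB addrC subrK.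
  split; first by rewrite -/(q' u) in h1; lra.
  move=> w uw wv; have [] := h2 (L - w) _ _; try lra.
  by [].
- move=> w w0 wT; have -> : q' (L - T) = q T by rewrite /q'; congr q; lra.
  by apply: Tmax; lra.
Qed.

(** * Length of curves *)

Section length.
Context {R : realType} {E : normedModType R}.
Implicit Types (g : R -> E) (a b s t : R) (p : seq R).

Fixpoint polygon_length g a p : R :=
  if p is x :: p' then `|g x - g a| + polygon_length g x p' else 0.

Lemma polygon_lengthE g a b p :
  \sum_(0 <= i < size p) `|g (nth b (a :: p) i.+1) - g (nth b (a :: p) i)| =
  polygon_length g a p.
Proof.
elim: p a => [|x p IH] a /=; first by rewrite big_geq.
by rewrite big_nat_recl//= IH.
Qed.

Lemma curve_lengthE g a b : curve_length g a b =
  ereal_sup [set (polygon_length g a p)%:E | p in [set p | itv_partition a b p]].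
Proof.
by congr ereal_sup; apply/seteqP; split=> _ [p pab <-]; exists p => //;
  rewrite polygon_lengthE.
Qed.

Lemma polygon_le_curve_length g a b p : itv_partition a b p ->
  ((polygon_length g a p)%:E <= curve_length g a b)%E.
Proof. by move=> pab; rewrite curve_lengthE; apply: ereal_sup_ubound; exists p. Qed.

Lemma curve_length_le g a b (y : \bar R) :
  (forall p, itv_partition a b p -> ((polygon_length g a p)%:E <= y)%E) ->
  (curve_length g a b <= y)%E.
Proof.
by move=> H; rewrite curve_lengthE; apply: ge_ereal_sup => _ [p pab <-]; exact: H.
Qed.

Lemma curve_lengthxx g a : curve_length g a a = 0%E.
Proof.
apply/eqP; rewrite eq_le; apply/andP; split.
  by apply: curve_length_le => p /itv_partitionxx ->.
exact: (@polygon_le_curve_length g a a [::]).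
Qed.

Lemma dist_le_curve_length g a b : a <= b ->
  (`|g b - g a|%:E <= curve_length g a b)%E.
Proof.
rewrite le_eqVlt => /orP[/eqP->|ab]; first by rewrite subrr normr0 curve_lengthxx.
have := polygon_le_curve_length g (itv_partition1 ab).
by rewrite /= addr0.
Qed.

Lemma curve_length_ge0 g a b : a <= b -> (0 <= curve_length g a b)%E.
Proof. by move=> /(dist_le_curve_length g); apply: le_trans; rewrite lee_fin. Qed.

Lemma polygon_length_cat g a p1 p2 :
  polygon_length g a (p1 ++ p2) = polygon_length g a p1 + polygon_length g (last a p1) p2.
Proof. by elim: p1 a => [|x p1 IH] a /=; rewrite ?add0r// IH addrA. Qed.

(** Inserting the vertex t does not shorten the polygon. *)
Lemma polygon_le_add_length g a t b p : a <= t -> t <= b -> itv_partition a b p ->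
  ((polygon_length g a p)%:E <= curve_length g a t + curve_length g t b)%E.
Proof.
move=> + tb; elim: p a => [|x p IH] a at_ pab.
  by apply: adde_ge0; apply: curve_length_ge0.
have [xt|tx] := leP x t.
  have [pxb ax] : itv_partition x b p /\ a < x.
    by split; [exact: itv_partition_cons pab|case: pab => /= /andP[]].
  rewrite /= EFinD.
  apply: (@le_trans _ _ (`|g x - g a|%:E + (curve_length g x t + curve_length g t b))%E).
    by apply: leeD2l; exact: IH.
  rewrite addeA; apply: leeD2r.
  rewrite addeC -leeBrDr//; apply: curve_length_le => q qxt; rewrite leeBrDr//.
  rewrite addeC -EFinD.
  apply: (@polygon_le_curve_length g a t (x :: q)).
  by case: qxt => h1 h2; split=> //=; rewrite ax.
have tpb : itv_partition t b (x :: p).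
  by case: pab => /= /andP[_ h1] h2; split=> //=; rewrite tx.
apply: le_trans (_ : (`|g t - g a|%:E + (polygon_length g t (x :: p))%:E <= _)%E).
  by rewrite -EFinD lee_fin /= addrA lerD2r addrC ler_distD.
by apply: leeD; [exact: dist_le_curve_length|exact: polygon_le_curve_length].
Qed.

Lemma curve_lengthD g a t b : a <= t -> t <= b ->
  curve_length g a b = (curve_length g a t + curve_length g t b)%E.
Proof.
move=> at_ tb; apply/eqP; rewrite eq_le; apply/andP; split.
  by apply: curve_length_le => p; exact: polygon_le_add_length.
have key p : itv_partition a t p ->
    ((polygon_length g a p)%:E + curve_length g t b <= curve_length g a b)%E.
  move=> pat; rewrite addeC -leeBrDr//; apply: curve_length_le => q qtb.
  rewrite leeBrDr// addeC -EFinD.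
  case: (pat) => _ /eqP lp; rewrite -[in X in _ + X]lp -polygon_length_cat.
  exact/polygon_le_curve_length/(itv_partition_cat pat qtb).
have := curve_length_ge0 g tb; case E1: (curve_length g t b) => [r| |] // _.
  rewrite -leeBrDr//; apply: curve_length_le => p /key; rewrite E1.
  by rewrite leeBrDr.
rewrite addey; last by have := curve_length_ge0 g at_; case: curve_length.
have [eq_at|ne_at] := eqVneq a t; first by rewrite eq_at E1.
have lt_at : a < t by rewrite lt_neqAle ne_at.
by have := key _ (itv_partition1 lt_at); rewrite E1 addey.
Qed.

Lemma curve_length_ext g g' a b : (forall t, a <= t -> t <= b -> g t = g' t) ->
  curve_length g a b = curve_length g' a b.
Proof.
have half g1 g2 : (forall t, a <= t -> t <= b -> g1 t = g2 t) ->
    (curve_length g1 a b <= curve_length g2 a b)%E.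
  move=> e; apply: curve_length_le => p pab.
  suff -> : polygon_length g1 a p = polygon_length g2 a p.
    exact: polygon_le_curve_length.
  elim: p a pab e => [//|x p IH] a' pab e /=.
  have pxb := itv_partition_cons pab.
  have ax : a' < x by case: pab => /= /andP[].
  have xb := itv_partition_le pxb.
  rewrite (IH _ pxb) => [|t xt tb]; first by rewrite !e// ?(ltW ax)// (le_trans _ xb)// ltW.
  by apply: e => //; apply: le_trans xt; exact: ltW.
by move=> e; apply/eqP; rewrite eq_le !half// => t ta tb; rewrite e.
Qed.

(** By additivity it suffices to compare one edge at a time, so that the partition
    need not be reversed. The reflection in c / 2 covers reversal, and two
    reflections make a translation. *)
Lemma curve_length_reflect g c a b : a <= b ->
  curve_length (fun r => g (c - r)) (c - b) (c - a) = curve_length g a b.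
Proof.
have half g1 a1 b1 : (curve_length (fun r => g1 (c - r)%R) a1 b1 <=
    curve_length g1 (c - b1)%R (c - a1)%R)%E.
  apply: curve_length_le => p; elim: p a1 => [|x p IH] a1 pab.
    by rewrite (itv_partition_nil pab) curve_lengthxx.
  have pxb := itv_partition_cons pab.
  have ax : a1 < x by case: pab => /= /andP[].
  have xb := itv_partition_le pxb.
  rewrite (@curve_lengthD _ _ (c - x)) ?lerB ?(ltW ax)// addeC /= EFinD.
  apply: leeD; last exact: IH.
  by rewrite distrC; apply: dist_le_curve_length; rewrite lerB ?(ltW ax).
move=> ab; apply/eqP; rewrite eq_le; apply/andP; split.
  apply: (le_trans (half _ _ _)); rewrite !opprB ![c + _]addrC !subrK.
  exact: lexx.
have := half (fun r => g (c - r)) a b.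
rewrite (@curve_length_ext (fun r => g (c - (c - r))) g) => [//|t _ _].
by rewrite opprB addrC subrK.
Qed.

Lemma within_itv_continuousP g a b : {within `[a, b], continuous g} <->
  forall x, a <= x -> x <= b -> forall e, 0 < e -> exists2 r, 0 < r &
    forall t, a <= t -> t <= b -> `|t - x| < r -> `|g t - g x| <= e.
Proof.
split.
  move=> /subspace_continuousP cg x ax xb e e0.
  have /cg/cvgrPdist_le/(_ _ e0) : `[a, b]%classic x by rewrite /= in_itv/= ax.
  move=> /nbhs_ballP[r /= r0 h]; exists r => // t at_ tb tx.
  rewrite distrC; apply: h; rewrite /= ?in_itv/= ?at_//.
  by rewrite /ball /= distrC.
move=> H; apply/subspace_continuousP => x /=; rewrite in_itv/= => /andP[ax xb].
apply/cvgrPdist_le => e e0; have [r r0 h] := H x ax xb e e0.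
apply/nbhs_ballP; exists r => //= t tx; rewrite in_itv/= => /andP[at_ tb].
by rewrite distrC; apply: h; rewrite // distrC.
Qed.

(** An inscribed polygon that is almost as long as the curve stays so after
    inserting a vertex t close to a; its first edge is short by continuity, and
    so the arc from a to t cannot be long. *)
Lemma curve_length_small_start g a b e : a < b -> {within `[a, b], continuous g} ->
  (curve_length g a b < +oo)%E -> 0 < e ->
  exists t, [/\ a < t, t <= b & (curve_length g a t <= e%:E)%E].
Proof.
move=> ab cg fin e0.
have fing : curve_length g a b \is a fin_num.
  by rewrite ge0_fin_numE// curve_length_ge0// ltW.
have e20 : 0 < e / 2 by lra.
have [p pab hp] : exists2 p, itv_partition a b p &
    (curve_length g a b - (e / 2)%:E < (polygon_length g a p)%:E)%E.
  have := fing; rewrite curve_lengthE => fing'.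
  have [_ [p pab <-] h] := ub_ereal_sup_adherent e20 fing'.
  by exists p.
case: p pab hp => [/itv_partition_nil|x p pab hp]; first by move: ab => /[swap] ->; rewrite ltxx.
have pxb := itv_partition_cons pab.
have ax : a < x by case: pab => /= /andP[].
have xb := itv_partition_le pxb.
have [r r0 hr] := (within_itv_continuousP g a b).1 cg a (lexx _) (ltW ab) _ e20.
pose t := Num.min ((a + x) / 2) (a + r / 2).
have at_ : a < t by rewrite lt_min; apply/andP; split; lra.
have tx : t < x by rewrite gt_min; apply/orP; left; lra.
have tr : t <= a + r / 2 by rewrite ge_min lexx orbT.
have tb := le_trans (ltW tx) xb.
exists t; split=> //.
have gt : `|g t - g a| <= e / 2.
  by apply: hr => //; [exact: ltW|rewrite ger0_norm ?subr_ge0 ?(ltW at_)//; lra].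
have txb : itv_partition t b (x :: p).
  by case: pab => /= /andP[_ h1] h2; split=> //=; rewrite tx.
have h1 : (curve_length g a t + curve_length g t b - (e / 2)%:E <
    (e / 2)%:E + curve_length g t b)%E.
  rewrite -curve_lengthD ?(ltW at_)//; apply: (lt_le_trans hp).
  (* The polygon with t inserted; its edge from a to t is at most e / 2. *)
  apply: le_trans (_ : ((e / 2)%:E + (polygon_length g t (x :: p))%:E <= _)%E).
    by rewrite -EFinD lee_fin /=; have := ler_distD (g t) (g x) (g a); lra.
  by apply: leeD2l; exact: polygon_le_curve_length.
move: fing h1; rewrite (@curve_lengthD g a t b) ?(ltW at_)//.
have := curve_length_ge0 g (ltW at_); have := curve_length_ge0 g tb.
case: (curve_length g a t) => [u| |] //; case: (curve_length g t b) => [v| |] //.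
rewrite -!EFinD !lte_fin !lee_fin; lra.
Qed.

Lemma curve_continuous_reflect g c a b : {within `[a, b], continuous g} ->
  {within `[c - b, c - a], continuous (fun r => g (c - r))}.
Proof.
move=> /within_itv_continuousP cg; apply/within_itv_continuousP => x ax xb e e0.
have [||r r0 h] := cg (c - x) _ _ e e0; try lra.
exists r => // t ta tb tx; apply: h; try lra.
by rewrite -normrN; move: tx; congr (`|_| < _); lra.
Qed.

Lemma curve_length_small_end g a b e : a < b -> {within `[a, b], continuous g} ->
  (curve_length g a b < +oo)%E -> 0 < e ->
  exists t, [/\ a <= t, t < b & (curve_length g t b <= e%:E)%E].
Proof.
move=> ab cg' fin e0; have cg := curve_continuous_reflect (c := 0) cg'.
have [||t [bt ta h]] := curve_length_small_start _ cg _ e0; first lra.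
  by rewrite curve_length_reflect ?(ltW ab).
exists (- t); split; [lra|lra|].
have tE : t = 0 - - t by lra.
by move: h; rewrite {1}tE curve_length_reflect//; lra.
Qed.

(** The arc length is nondecreasing, and continuous from the right and from the
    left by curve_length_small_start and curve_length_small_end; the value r
    is taken at the last time at which the length is at most r. *)
Lemma curve_length_ivt g a b r : a <= b -> {within `[a, b], continuous g} ->
  (curve_length g a b < +oo)%E -> (0 <= r%:E)%E -> (r%:E <= curve_length g a b)%E ->
  exists t, [/\ a <= t, t <= b & curve_length g a t = r%:E].
Proof.
move=> ab cg fin r0 rL.
have fin_sub s t : a <= s -> s <= t -> t <= b -> (curve_length g s t < +oo)%E.
  move=> as_ st tb; apply: le_lt_trans fin.
  rewrite (@curve_lengthD g a s b)// ?(le_trans st)// (@curve_lengthD g s t b)//.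
  rewrite (le_trans _ (leeDr _ (curve_length_ge0 _ as_)))//.
  by rewrite leeDl// curve_length_ge0.
have cg_sub s t : a <= s -> t <= b -> {within `[s, t], continuous g}.
  move=> as_ tb; apply: continuous_subspaceW cg.
  by move=> x /=; rewrite !in_itv/= => /andP[sx xt]; rewrite (le_trans as_)// (le_trans xt).
pose S := [set t | [/\ a <= t, t <= b & (curve_length g a t <= r%:E)%E]].
have Sa : S a by rewrite /S/= curve_lengthxx.
have supS : has_sup S by split; [exists a|exists b => t []].
have a_s : a <= sup S by exact: (ub_le_sup supS.2 Sa).
have s_b : sup S <= b by apply: ge_sup => [|t []//]; exists a.
have len_mono s t : a <= s -> s <= t -> (curve_length g a s <= curve_length g a t)%E.
  by move=> as_ st; rewrite (@curve_lengthD g a s t)// leeDl// curve_length_ge0.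
exists (sup S); split=> //; apply/eqP; rewrite eq_le; apply/andP; split.
  rewrite leNgt; apply/negP => lt_r.
  have a_s' : a < sup S.
    by rewrite lt_neqAle a_s andbT; apply/eqP => e; move: lt_r; rewrite -e curve_lengthxx ltNge r0.
  have := fin_sub _ _ (lexx a) a_s s_b; have := curve_length_ge0 g a_s.
  case El : (curve_length g a (sup S)) lt_r => [l| |] // lt_r _ _.
  rewrite lte_fin in lt_r.
  have e0 : 0 < (l - r) / 2 by lra.
  have [t [at_ ts ht]] := curve_length_small_end a_s' (cg_sub _ _ (lexx _) s_b)
    (fin_sub _ _ (lexx _) a_s s_b) e0.
  have st0 : 0 < sup S - t by lra.
  have [u [au ub hu] tu] := sup_adherent st0 supS.
  have {}tu : t < u by move: tu; rewrite opprB addrC subrK.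
  have := le_trans (len_mono _ _ at_ (ltW tu)) hu.
  move: El; rewrite (@curve_lengthD g a t (sup S)) ?(ltW ts)//.
  have := curve_length_ge0 g at_; have := curve_length_ge0 g (ltW ts).
  move: ht; case: (curve_length g t _) => [v| |] //; case: (curve_length g a t) => [w| |] //.
  by rewrite -EFinD !lee_fin => + _ _ [] lE; lra.
rewrite leNgt; apply/negP => lt_r.
have s_b' : sup S < b.
  by rewrite lt_neqAle s_b andbT; apply/eqP => e; move: lt_r; rewrite e ltNge rL.
have := curve_length_ge0 g a_s.
case El : (curve_length g a (sup S)) lt_r => [l| |] // lt_r _.
rewrite lte_fin in lt_r.
have e0 : 0 < r - l by lra.
have [t [st tb ht]] := curve_length_small_start s_b' (cg_sub _ _ a_s (lexx _))
    (fin_sub _ _ a_s s_b (lexx _)) e0.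
have : t <= sup S.
  apply: (ub_le_sup supS.2); split=> //; first exact: le_trans (ltW st).
  rewrite (@curve_lengthD g a (sup S) t) ?(ltW st)// El.
  by apply: (le_trans (leeD2l _ ht)); rewrite -EFinD lee_fin; lra.
by rewrite leNgt st.
Qed.

End length.

(** * Primitives on a segment *)

Section primitive.
Context {R : realType}.
Implicit Types (f F : R -> R).

Definition primitive_on f F (a b : R) :=
  forall x : R, a <= x -> x <= b -> is_derive x (1 : R) F (f x).

Lemma primitive_continuous f F a b : primitive_on f F a b ->
  {within `[a, b], continuous F}.
Proof.
move=> dF; apply: derivable_within_continuous => x; rewrite in_itv/= => /andP[ax xb].
by have [] := dF x ax xb.
Qed.

Lemma primitive_exists f L : 0 <= L -> continuous f -> exists F, primitive_on f F 0 L.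
Proof.
move=> L0 cf.
have int : lebesgue_measure.-integrable `[-1, L + 1] (EFin \o f).
  apply: continuous_compact_integrable; first exact: segment_compact.
  exact: continuous_subspaceT.
(* Integrating from -1 gives a two-sided derivative also at 0. *)
exists (fun x => \int[lebesgue_measure]_(t in `[-1, x]) f t) => x x0 xL.
have [||dF DF] := @continuous_FTC1_closed R f (-1) x (L + 1) _ int _ (cf x); try lra.
by rewrite -DF derive1E; exact: derivableP.
Qed.

Lemma integral_primitive f F a b : a <= b -> continuous f -> primitive_on f F a b ->
  (\int[lebesgue_measure]_(x in `[a, b]) (f x)%:E = (F b - F a)%:E)%E.
Proof.
rewrite le_eqVlt => /predU1P[->|ab] cf dF; first by rewrite set_itv1 integral_set1 subrr.
rewrite (continuous_FTC2 ab _ _ (F := F))//.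
- exact: continuous_subspaceT.
- have := primitive_continuous dF => /(continuous_within_itvP _ ab)[_ c1 c2].
  split=> // x; rewrite in_itv/= => /andP[ax xb].
  by have [] := dF x (ltW ax) (ltW xb).
- move=> x; rewrite in_itv/= => /andP[ax xb].
  by have [_ <-] := dF x (ltW ax) (ltW xb); rewrite derive1E.
Qed.

Lemma primitive_le f F g G a b : a <= b -> primitive_on f F a b ->
  primitive_on g G a b -> (forall x, a <= x -> x <= b -> f x <= g x) ->
  F b - F a <= G b - G a.
Proof.
move=> ab dF dG fg.
have dGF : primitive_on (g - f) (G - F) a b.
  by move=> x ax xb; have := dF x ax xb; have := dG x ax xb; move=> ? ?; exact: is_deriveB.
have dGFoo x : x \in `]a, b[%R -> is_derive x (1 : R) (G - F) ((g - f) x).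
  by rewrite in_itv/= => /andP[ax xb]; apply: dGF; exact: ltW.
have [c] := MVT_segment ab dGFoo (primitive_continuous dGF).
rewrite in_itv/= => /andP[ac cb] e.
have : 0 <= (g - f) c * (b - a).
  by rewrite mulr_ge0 ?subr_ge0//=; exact: fg.
by rewrite -e !fctE; lra.
Qed.

Lemma primitive_sub f F a b s t : primitive_on f F a b -> a <= s -> t <= b ->
  primitive_on f F s t.
Proof. by move=> dF as_ tb x sx xt; apply: dF; [exact: (le_trans as_)|exact: (le_trans xt)]. Qed.

Lemma primitive_shift f F a b c : primitive_on f F (a + c) (b + c) ->
  primitive_on (fun x => f (x + c)) (fun x => F (x + c)) a b.
Proof.
move=> dF x ax xb.
have h := dF (x + c) _ _; have {}h : is_derive (x + c) 1 F (f (x + c)) by apply: h; lra.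
have h2 : is_derive x (1 : R) (fun x => x + c) 1.
  by apply: is_derive_eq; rewrite addr0.
have := @is_derive1_comp R F (fun x => x + c) x (f (x + c)) 1 h h2.
by rewrite mulr1.
Qed.

Lemma primitive_reflect f F a b c : primitive_on f F (c - b) (c - a) ->
  primitive_on (fun x => f (c - x)) (fun x => - F (c - x)) a b.
Proof.
move=> dF x ax xb.
have h := dF (c - x) _ _; have {}h : is_derive (c - x) 1 F (f (c - x)) by apply: h; lra.
have h2 : is_derive x (1 : R) (fun x => c - x) (-1).
  have := @is_deriveB _ _ _ (cst c) id x 1 0 1 (is_derive_cst _ _ _) (is_derive_id _ _).
  by rewrite sub0r.
have h3 := @is_derive1_comp R F (fun x => c - x) x (f (c - x)) (-1) h h2.
have h4 := @is_deriveN _ _ _ _ _ _ _ h3.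
by move: h4; rewrite mulrN1 opprK.
Qed.

Lemma primitive_linear (k a b : R) : primitive_on (fun _ => k) (fun x => k * x) a b.
Proof.
move=> x _ _; apply: is_derive_eq.
by rewrite /= scaler1.
Qed.

Lemma primitive_ln (k a b c : R) : 0 < c + a ->
  primitive_on (fun x => k / (c + x)) (fun x => k * ln (c + x)) a b.
Proof.
move=> ca x ax xb.
have p : 0 < c + x by lra.
have h2 : is_derive x (1 : R) (fun x => c + x) 1.
  have := @is_deriveD _ _ _ (cst c) id x 1 0 1 (is_derive_cst _ _ _) (is_derive_id _ _).
  by rewrite add0r.
have h1 := @is_derive1_ln R (c + x) p.
have h3 := @is_derive1_comp R (@ln R) (fun x => c + x) x _ _ h1 h2.
have := @is_deriveZ _ _ _ _ k _ _ _ h3.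
by rewrite mulr1.
Qed.

End primitive.

(** * Distance to the boundary *)

Section boundary_distance.
Context {R : realType} {E : normedModType R} {D : set E}.
Hypothesis openD : open D.

(** If the boundary were empty, D would be open and closed, and so would its trace on
    a segment from a point of D to an arbitrary point. *)
Lemma boundary_nonempty : D !=set0 -> D <> setT -> boundary D !=set0.
Proof.
move=> [z Dz] DT; apply: contrapT => bd0.
have closedD : closed D.
  move=> x clDx; apply: contrapT => nDx; apply: bd0; exists x; split=> //.
  by move=> /interior_subset.
apply: DT; apply/seteqP; split=> // w _.
pose f (t : R) : E := z + t *: (w - z).
have cf : continuous f.
  move=> t; apply: cvgD; first exact: cvg_cst.
  by apply: cvgZr_tmp; exact: cvg_id.
have := @segment_connected R 0 1 (`[0, 1]%classic `&` f @^-1` D).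
have h0 : (`[0, 1]%classic `&` f @^-1` D) 0.
  by split; rewrite /= ?in_itv/= ?lexx ?ler01// /f scale0r addr0.
move=> /(_ (ex_intro _ 0 h0)) H.
have {}H : `[0, 1]%classic `&` f @^-1` D = `[0, 1]%classic.
  apply: H; exists (f @^-1` D) => //.
    by apply: open_comp => // x _; exact: cf.
  by apply: closed_comp => // x _; exact: cf.
have : (`[0, 1]%classic : set R) 1 by rewrite /= in_itv/= ler01 lexx.
by rewrite -H => -[_]; rewrite /f /= scale1r addrC subrK.
Qed.

Hypothesis bd : boundary D !=set0.

Lemma bdist_lipschitz z w : bdist D w <= bdist D z + `|w - z|.
Proof.
rewrite -lerBlDr; apply: lb_le_inf; first by case: bd => x ?; exists `|z - x|; exists x.
move=> _ [x bx <-]; rewrite lerBlDr addrC.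
apply: (le_trans _ (ler_distD z w x)).
by apply: ge_inf; [exists 0 => _ [y _ <-]|exists x].
Qed.

Lemma bdist_gt0 z : D z -> 0 < bdist D z.
Proof.
move=> Dz; have /nbhs_ballP[r /= r0 hr] : nbhs z D by exact: open_nbhs_nbhs.
apply: (lt_le_trans r0); apply: lb_le_inf.
  by case: bd => x ?; exists `|z - x|; exists x.
move=> _ [x [_ nx] <-]; rewrite leNgt; apply/negP => lt.
apply: nx; move: openD => /interior_id ->; apply: hr.
by rewrite -ball_normE.
Qed.

End boundary_distance.

(** * Arc length parametrization *)

Section arclength.
Context {R : realType} {E : normedModType R}.
Implicit Types (g h : R -> E) (a b s t : R) (l : R -> R).

(** Here l t is the length up to the time t, and h is the curve as a function
    of that length. The function h is extended to the whole line as a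
    1-Lipschitz map with values on the curve, which spares restrictions to
    segments. *)
Definition arclength g a b l h :=
  [/\ a <= b /\ l a = 0,
      forall s t, a <= s -> s <= t -> t <= b -> curve_length g s t = (l t - l s)%:E,
      forall u, 0 <= u -> u <= l b -> exists t, [/\ a <= t, t <= b & l t = u],
      forall t, a <= t -> t <= b -> h (l t) = g t &
      (forall u v, `|h v - h u| <= `|v - u|) /\
      forall u, exists t, [/\ a <= t, t <= b & h u = g t]].

Lemma arclength_homo g a b l h s t : arclength g a b l h ->
  a <= s -> s <= t -> t <= b -> l s <= l t.
Proof.
move=> [_ len _ _ _] as_ st tb.
by have := curve_length_ge0 g st; rewrite len// lee_fin subr_ge0.
Qed.

Lemma arclength_exists D g a b : rectifiable_in D g a b ->
  exists l h, arclength g a b l h.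
Proof.
move=> [[ab cg gD] fin].
pose l t := fine (curve_length g a t).
have len_fin s t : a <= s -> s <= t -> t <= b -> curve_length g s t \is a fin_num.
  move=> as_ st tb; rewrite ge0_fin_numE ?curve_length_ge0//.
  apply: le_lt_trans fin.
  rewrite (@curve_lengthD _ _ g a s b)// ?(le_trans st)// (@curve_lengthD _ _ g s t b)//.
  rewrite (le_trans _ (leeDr _ (curve_length_ge0 _ as_)))//.
  by rewrite leeDl// curve_length_ge0.
have lE t : a <= t -> t <= b -> curve_length g a t = (l t)%:E.
  by move=> at_ tb; rewrite fineK//; exact: len_fin.
have len s t : a <= s -> s <= t -> t <= b -> curve_length g s t = (l t - l s)%:E.
  move=> as_ st tb; have := lE t (le_trans as_ st) tb.
  rewrite (@curve_lengthD _ _ g a s t)// (lE s)//; last exact: le_trans tb.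
  have := len_fin s t as_ st tb; case: (curve_length g s t) => [r| |]// _.
  by rewrite -EFinD => -[<-]; congr EFin; lra.
have l0 : l a = 0 by rewrite /l curve_lengthxx.
have dist s t : a <= s -> s <= b -> a <= t -> t <= b -> `|g t - g s| <= `|l t - l s|.
  move=> as_ sb at_ tb; wlog st : s t as_ sb at_ tb / s <= t.
    move=> H; have [st|/ltW ts] := leP s t; first exact: H.
    by rewrite distrC [leRHS]distrC; exact: H.
  have := dist_le_curve_length g st; rewrite len// lee_fin => /le_trans; apply.
  exact: ler_norm.
have surj u : 0 <= u -> u <= l b -> exists t, [/\ a <= t, t <= b & l t = u].
  move=> u0 ul; have [||t [at_ tb h]] := @curve_length_ivt _ _ g a b u ab cg fin _ _.
  - by rewrite lee_fin.
  - by rewrite lE// lee_fin.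
  by exists t; split=> //; rewrite /l h.
have lb0 : 0 <= l b by rewrite -lee_fin -lE// curve_length_ge0.
pose clamp u := Num.max 0 (Num.min u (l b)).
have clamp0 u : 0 <= clamp u by rewrite le_max lexx.
have clampb u : clamp u <= l b by rewrite ge_max lb0 ge_min lexx orbT.
have clampE u : 0 <= u -> u <= l b -> clamp u = u.
  by move=> u0 ub; rewrite /clamp min_l// max_r.
have clamp_lip u v : `|clamp v - clamp u| <= `|v - u|.
  wlog uv : u v / u <= v.
    move=> H; have [uv|/ltW vu] := leP u v; first exact: H.
    by rewrite distrC [leRHS]distrC; exact: H.
  rewrite [leRHS]ger0_norm ?subr_ge0// ler_norml /clamp.
  rewrite /Num.max /Num.min; do !case: ifP; move=> *; lra.
pose h u := arc_param g a b (clamp u).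
have hP u : exists t, [/\ a <= t, t <= b, l t = clamp u & h u = g t].
  have [t [at_ tb lt]] := surj _ (clamp0 u) (clampb u).
  pose P := [set t | t \in `[a, b] /\ curve_length g a t = (clamp u)%:E].
  have : P (xget a P).
    by apply: xgetPex; exists t; split; rewrite ?in_itv/= ?at_// lE// lt.
  case; rewrite in_itv/= => /andP[h1 h2] h3.
  by exists (xget a P); split=> //; rewrite /l h3.
exists l, h; split=> //.
- move=> t at_ tb; have [s [as_ sb ls ->]] := hP (l t).
  have lt0 : 0 <= l t by rewrite -lee_fin -lE// curve_length_ge0.
  have ltb : l t <= l b.
    by have := curve_length_ge0 g tb; rewrite len// lee_fin subr_ge0.
  rewrite clampE// in ls.
  have := dist s t as_ sb at_ tb; rewrite ls subrr normr0 normr_le0 subr_eq0.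
  by move/eqP.
- split=> [u v|u]; last by have [t [? ? _ ?]] := hP u; exists t.
  have [s [as_ sb ls ->]] := hP u; have [t [at_ tb lt ->]] := hP v.
  by apply: (le_trans (dist _ _ _ _ _ _)) => //; rewrite ls lt.
Qed.

End arclength.

(** * Quasihyperbolic length *)

Section quasihyperbolic.
Context {R : realType} {E : normedModType R} {D : set E}.
Hypothesis openD : open D.
Hypothesis bd : boundary D !=set0.
Implicit Types (g h : R -> E) (a b s t : R) (l : R -> R).

Let rho h u := (bdist D (h u))^-1.

Lemma bdist_path_lipschitz h : (forall u v, `|h v - h u| <= `|v - u|) ->
  forall u v, bdist D (h v) <= bdist D (h u) + `|v - u|.
Proof. by move=> hl u v; apply: (le_trans (bdist_lipschitz bd (h u) (h v))); rewrite lerD2l. Qed.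

Lemma density_continuous h : (forall u v, `|h v - h u| <= `|v - u|) ->
  (forall u, D (h u)) -> continuous (rho h).
Proof.
move=> hl hD u; apply: cvgV; first by rewrite gt_eqF// bdist_gt0.
exact: (one_lipschitz_continuous (bdist_path_lipschitz hl)).
Qed.

(** The choice of parameters in arc_param does not matter: k is any function that
    agrees with the curve as a function of arc length. *)
Lemma qh_length_primitive g s t L k F : 0 <= L -> curve_length g s t = L%:E ->
  (forall u, 0 <= u -> u <= L -> exists r, [/\ s <= r, r <= t & curve_length g s r = u%:E]) ->
  (forall r u, s <= r -> r <= t -> curve_length g s r = u%:E -> k u = g r) ->
  continuous (rho k) -> primitive_on (rho k) F 0 L ->
  qh_length D g s t = (F L - F 0)%:E.
Proof.
move=> L0 len surj kE ck dF; rewrite -(integral_primitive L0 ck dF) /qh_length len /=.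
apply: eq_integral => u; rewrite inE/= in_itv/= => /andP[u0 uL].
congr (_^-1)%:E; congr bdist; have [r [sr rt hr]] := surj u u0 uL.
pose P := [set r | r \in `[s, t] /\ curve_length g s r = u%:E].
have [] : P (xget s P) by apply: xgetPex; exists r; split; rewrite ?in_itv/= ?sr.
by rewrite in_itv/= => /andP[h1 h2] h3; rewrite (kE _ _ h1 h2 h3).
Qed.

Lemma arclength_in g a b l h : curve_in D g a b -> arclength g a b l h ->
  forall u, D (h u).
Proof.
move=> [_ _ gD] [_ _ _ _ [_ hg]] u; have [t [at_ tb ->]] := hg u.
by apply: gD; exists t => //=; rewrite in_itv/= at_.
Qed.

Lemma arclength_primitive g a b l h : curve_in D g a b -> arclength g a b l h ->
  exists F, primitive_on (rho h) F 0 (l b).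
Proof.
move=> gD al; apply: primitive_exists.
  by case: (al) => -[ab <-] _ _ _ _; exact: (arclength_homo al).
by apply: density_continuous; [case: al => _ _ _ _ []|exact: arclength_in al].
Qed.

Lemma qh_length_arclength g a b l h F : curve_in D g a b -> arclength g a b l h ->
  primitive_on (rho h) F 0 (l b) ->
  forall s t, a <= s -> s <= t -> t <= b ->
    qh_length D g s t = (F (l t) - F (l s))%:E.
Proof.
move=> gD al dF s t as_ st tb; have mono := arclength_homo al.
have hD := arclength_in gD al.
case: (al) => -[ab l0] len surj hl [hlip _].
have -> : F (l t) - F (l s) = F (l t - l s + l s) - F (0 + l s) by rewrite subrK add0r.
have ls0 : 0 <= l s by rewrite -l0; apply: mono => //; exact: le_trans tb.
have ltb : l t <= l b by apply: mono => //; exact: le_trans st.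
apply: (@qh_length_primitive g s t (l t - l s) (fun u => h (u + l s))
  (fun u => F (u + l s))).
- by rewrite subr_ge0 mono.
- exact: len.
- move=> u u0 ut; have [||r [ar rb lr]] := surj (u + l s); try lra.
  have [sr|/ltW rs] := leP s r.
    have [rt|/ltW tr] := leP r t.
      by exists r; split=> //; rewrite len// lr addrK.
    exists t; split=> //; rewrite len//; congr EFin.
    have := mono _ _ (le_trans as_ st) tr rb; lra.
  exists s; split=> //; rewrite len// ?(le_trans st)//; congr EFin.
  have := mono _ _ ar rs (le_trans st tb); lra.
- move=> r u sr rt; rewrite len// ?(le_trans rt)// => -[<-].
  by rewrite subrK hl// ?(le_trans as_)// (le_trans rt).
- apply: density_continuous => // u v.
  by apply: (le_trans (hlip _ _)); rewrite opprD addrACA subrr addr0.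
- apply: (@primitive_shift _ (rho h)); apply: primitive_sub dF _ _; lra.
Qed.

Definition qh_joined (x y : E) (r : R) := exists g a b,
  [/\ rectifiable_in D g a b, g a = x, g b = y & qh_length D g a b = r%:E].

Lemma rectifiable_qh_joined g a b : rectifiable_in D g a b ->
  exists r, qh_length D g a b = r%:E /\ qh_joined (g a) (g b) r.
Proof.
move=> rg; have [l [h al]] := arclength_exists rg; case: (rg) => gD _.
have [F dF] := arclength_primitive gD al.
case: (al) => -[ab _] _ _ _ _.
have e := qh_length_arclength gD al dF (lexx _) ab (lexx _).
by exists (F (l b) - F (l a)); split=> //; exists g, a, b.
Qed.

Lemma rectifiable_sub g a b s t : rectifiable_in D g a b ->
  a <= s -> s <= t -> t <= b -> rectifiable_in D g s t.
Proof.
move=> [[ab cg gD] fin] as_ st tb.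
have sub : `[s, t]%classic `<=` `[a, b]%classic.
  by move=> x /=; rewrite !in_itv/= => /andP[sx xt]; rewrite (le_trans as_)// (le_trans xt).
split; first split=> //.
- exact: continuous_subspaceW cg.
- by move=> _ [x /sub abx <-]; apply: gD; exists x.
apply: le_lt_trans fin.
rewrite (@curve_lengthD _ _ g a s b)// ?(le_trans st)// (@curve_lengthD _ _ g s t b)//.
rewrite (le_trans _ (leeDr _ (curve_length_ge0 _ as_)))//.
by rewrite leeDl// curve_length_ge0.
Qed.

Lemma rectifiable_reflect g c a b : rectifiable_in D g a b ->
  rectifiable_in D (fun r => g (c - r)) (c - b) (c - a).
Proof.
move=> [[ab cg gD] fin]; split; last by rewrite curve_length_reflect.
split; first by rewrite lerB.
  exact: curve_continuous_reflect.
move=> _ [x + <-]; rewrite /= in_itv/= => /andP[bx xa].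
by apply: gD; exists (c - x) => //=; rewrite in_itv/=; lra.
Qed.

Lemma qh_length_reflect g c a b : rectifiable_in D g a b ->
  qh_length D (fun r => g (c - r)) (c - b) (c - a) = qh_length D g a b.
Proof.
move=> rg; have [l [h al]] := arclength_exists rg; case: (rg) => gD _.
have [F dF] := arclength_primitive gD al; have hD := arclength_in gD al.
case: (al) => -[ab l0] len surj hl [hlip _].
rewrite (qh_length_arclength gD al dF (lexx _) ab (lexx _)) l0.
have len' r : c - b <= r -> r <= c - a ->
    curve_length (fun r => g (c - r)) (c - b) r = (l b - l (c - r))%:E.
  move=> br ra; have rE : r = c - (c - r) by lra.
  by rewrite {1}rE curve_length_reflect ?len//; lra.
have -> : F (l b) - F 0 = - F (l b - l b) - - F (l b - 0) by rewrite subrr subr0; lra.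
apply: (@qh_length_primitive _ _ _ (l b) (fun u => h (l b - u)) (fun u => - F (l b - u))).
- by rewrite -l0; exact: (arclength_homo al).
- rewrite len'; [|lra|lra]; congr EFin.
  have -> : c - (c - a) = a by lra.
  by rewrite l0 subr0.
- move=> u u0 ul; have [||t [at_ tb lt]] := surj (l b - u); try lra.
  exists (c - t); split; [lra|lra|rewrite len'; [|lra|lra]].
  have -> : c - (c - t) = t by lra.
  by congr EFin; rewrite lt; lra.
- move=> r u br ra; rewrite len'// => -[<-].
  by rewrite opprB addrC subrK hl//; lra.
- apply: density_continuous => // u v.
  apply: (le_trans (hlip _ _)).
  have -> : l b - v - (l b - u) = - (v - u) by lra.
  by rewrite normrN.
- by apply: (@primitive_reflect _ (rho h)); rewrite subr0 subrr.
Qed.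

Lemma qh_joined_sym x y r : qh_joined x y r -> qh_joined y x r.
Proof.
move=> [g [a [b [rg ga gb e]]]].
exists (fun u => g (0 - u)), (0 - b), (0 - a); split.
- exact: rectifiable_reflect.
- by rewrite opprB addrC subrK.
- by rewrite opprB addrC subrK.
- by rewrite qh_length_reflect.
Qed.

(** A reflection of the reversed curve is a translate of the original one. *)
Lemma qh_joined_start x y (r c : R) : qh_joined x y r -> exists g b,
  [/\ rectifiable_in D g c b, g c = x, g b = y & qh_length D g c b = r%:E].
Proof.
move=> /qh_joined_sym[g [a [b [rg ga gb e]]]].
exists (fun u => g (c + b - u)), (c + b - a).
have cE : c + b - b = c by lra.
have := rectifiable_reflect (c + b) rg; have := qh_length_reflect (c + b) rg.
rewrite cE => h1 h2; split=> //.
- by have -> : c + b - c = b by lra.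
- by have -> : c + b - (c + b - a) = a by lra.
- by rewrite h1.
Qed.

Lemma qh_joined_refl x : D x -> qh_joined x x 0.
Proof.
move=> Dx; have rx : rectifiable_in D (fun=> x) 0 0.
  split; last by rewrite curve_lengthxx.
  split=> //; last by move=> _ [_ _ <-].
  by apply: continuous_subspaceT => ?; exact: cvg_cst.
exists (fun=> x), 0, 0; split=> //.
by rewrite /qh_length curve_lengthxx/= set_itv1 integral_set1.
Qed.

Lemma qh_length_ext g g' a b : (forall t, a <= t -> t <= b -> g t = g' t) ->
  a <= b -> qh_length D g a b = qh_length D g' a b.
Proof.
move=> e ab; rewrite /qh_length (curve_length_ext e).
suff -> : arc_param g a b = arc_param g' a b by [].
apply/funext => u; rewrite /arc_param.
have -> : [set t | t \in `[a, b] /\ curve_length g a t = u%:E] =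
    [set t | t \in `[a, b] /\ curve_length g' a t = u%:E].
  apply/seteqP; split=> t /= [tab <-]; split=> //; apply: curve_length_ext => w aw wt;
  by [rewrite e//; move: tab; rewrite in_itv/= => /andP[_]; exact: le_trans
     |rewrite -e//; move: tab; rewrite in_itv/= => /andP[_]; exact: le_trans].
set P := [set t | _].
have [nP|/set0P[t Pt]] := eqVneq P set0.
  by rewrite xgetPN ?e// => t; rewrite nP.
have [] : P (xget a P) by apply: xgetPex; exists t.
by rewrite in_itv/= => /andP[h1 h2] _; exact: e.
Qed.

Lemma rectifiable_glue g a b c : a <= b -> b <= c ->
  rectifiable_in D g a b -> rectifiable_in D g b c -> rectifiable_in D g a c.
Proof.
move=> ab bc [[_ c1 gD1] fin1] [[_ c2 gD2] fin2]; split; last first.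
  by rewrite (curve_lengthD _ ab bc) lte_add_pinfty.
split; first exact: le_trans bc.
  apply/within_itv_continuousP => x ax xc e e0.
  move/within_itv_continuousP in c1; move/within_itv_continuousP in c2.
  have left_ : exists2 r, 0 < r & forall t, a <= t -> t <= b -> `|t - x| < r -> `|g t - g x| <= e.
    have [xb|bx] := leP x b; first exact: c1.
    by exists (x - b); [lra|move=> t at_ tb; rewrite ltr_norml; lra].
  have right_ : exists2 r, 0 < r & forall t, b <= t -> t <= c -> `|t - x| < r -> `|g t - g x| <= e.
    have [bx|xb] := leP b x; first exact: c2.
    by exists (b - x); [lra|move=> t at_ tb; rewrite ltr_norml; lra].
  have [r1 r10 h1] := left_; have [r2 r20 h2] := right_.
  exists (Num.min r1 r2); first by rewrite lt_min r10.
  move=> t at_ tc; rewrite lt_min => /andP[t1 t2].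
  by have [tb|/ltW bt] := leP t b; [exact: h1|exact: h2].
move=> _ [t + <-]; rewrite /= in_itv/= => /andP[at_ tc].
have [tb|/ltW bt] := leP t b.
  by apply: gD1; exists t => //=; rewrite in_itv/= at_.
by apply: gD2; exists t => //=; rewrite in_itv/= bt.
Qed.

Lemma rectifiable_ext g g' a b : (forall t, a <= t -> t <= b -> g t = g' t) ->
  rectifiable_in D g a b -> rectifiable_in D g' a b.
Proof.
move=> e [[ab cg gD] fin]; split; last by rewrite -(curve_length_ext e).
split=> //.
  apply: subspace_eq_continuous cg => x; rewrite inE /= in_itv/= => /andP[ax xb].
  exact: e.
move=> _ [t + <-]; rewrite /= in_itv/= => /andP[at_ tb].
by rewrite -e//; apply: gD; exists t => //=; rewrite in_itv/= at_.
Qed.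

Lemma qh_joined_trans x y z r1 r2 : qh_joined x y r1 -> qh_joined y z r2 ->
  qh_joined x z (r1 + r2).
Proof.
move=> [g1 [a [b [rg1 g1a g1b e1]]]] /(@qh_joined_start _ _ _ b)[g2 [c [rg2 g2b g2c e2]]].
have ab : a <= b by case: rg1 => -[].
have bc : b <= c by case: rg2 => -[].
pose g t := if t <= b then g1 t else g2 t.
have gE1 t : a <= t -> t <= b -> g1 t = g t by move=> _ tb; rewrite /g tb.
have gE2 t : b <= t -> t <= c -> g2 t = g t.
  rewrite le_eqVlt /g => /predU1P[<- _|bt _]; first by rewrite lexx g2b g1b.
  by rewrite leNgt bt.
have rg := rectifiable_glue ab bc (rectifiable_ext gE1 rg1) (rectifiable_ext gE2 rg2).
exists g, a, c; split=> //; first by rewrite -gE1.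
  by rewrite -gE2.
have [l [h al]] := arclength_exists rg; case: (rg) => gD _.
have [F dF] := arclength_primitive gD al.
have len := qh_length_arclength gD al dF.
rewrite len// ?(le_trans ab)//.
move: e1 e2; rewrite (qh_length_ext gE1)// (qh_length_ext gE2)// !len//.
by move=> [<-] [<-]; congr EFin; lra.
Qed.

(** After arc length u the boundary distance is at most bdist D x + u, so the
    quasihyperbolic length of a curve of length l is at least
    ln ((bdist D x + l) / bdist D x). *)
Lemma qh_joined_bdist x y r : qh_joined x y r ->
  0 <= r /\ bdist D y <= bdist D x * expR r.
Proof.
move=> [g [a [b [rg <- <- e]]]].
have [l [h al]] := arclength_exists rg; case: (rg) => gD _.
have [F dF] := arclength_primitive gD al; have hD := arclength_in gD al.
have l_ge0 := arclength_homo al (lexx _).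
move: e; case: (al) => -[ab l0] _ _ hl [hlip _].
have {l_ge0} lb0 : 0 <= l b by rewrite -l0; exact: l_ge0.
rewrite (qh_length_arclength gD al dF)// l0 => -[<-].
rewrite -(hl a)// -(hl b)// l0.
have x0 : 0 < bdist D (h 0) by exact: bdist_gt0.
split.
  have := @primitive_le _ _ _ _ _ 0 (l b) lb0 (@primitive_linear _ 0 0 (l b)) dF.
  rewrite mul0r mulr0 subrr; apply=> u _ _.
  by rewrite invr_ge0 ltW// bdist_gt0.
have x0' : 0 < bdist D (h 0) + 0 by rewrite addr0.
have := primitive_le lb0 (@primitive_ln _ 1 0 (l b) _ x0') dF.
rewrite !mul1r addr0 => H.
have {}H : ln (bdist D (h 0) + l b) - ln (bdist D (h 0)) <= F (l b) - F 0.
  apply: H => u u0 ul; rewrite div1r lef_pV2 ?posrE ?bdist_gt0//; last lra.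
  have := bdist_path_lipschitz hlip 0 u; rewrite subr0 ger0_norm//.
have h1 := bdist_path_lipschitz hlip 0 (l b); rewrite subr0 ger0_norm// in h1.
apply: (le_trans h1).
have p : 0 < bdist D (h 0) + l b by lra.
rewrite -[leLHS]lnK ?posrE//.
rewrite -{2}[bdist D (h 0)]lnK ?posrE// -expRD ler_expR; lra.
Qed.

End quasihyperbolic.

(** * The quasihyperbolic metric *)

Section quasihyperbolic_metric.
Context {R : realType} {E : normedModType R} {D : set E}.
Hypothesis openD : open D.
Hypothesis bd : boundary D !=set0.
Hypothesis joined : forall x y, D x -> D y -> exists r, qh_joined (D := D) x y r.

Lemma qh_dist_fin x y r : qh_joined (D := D) x y r ->
  exists2 k, qh_dist D x y = k &
    (k <= r /\ forall e, 0 < e -> exists2 r', qh_joined (D := D) x y r' & r' <= k + e).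
Proof.
move=> xyr; rewrite /qh_dist; set S := [set l | _].
have SP l : S l -> exists2 r', l = r'%:E & qh_joined (D := D) x y r'.
  move=> [g [a [b [rg <- <- ->]]]].
  by have [r' [e j]] := rectifiable_qh_joined openD bd rg; exists r'.
have Sj r' : qh_joined (D := D) x y r' -> S r'%:E.
  by move=> [g [a [b [rg ga gb e]]]]; exists g, a, b.
have ge0 : (0 <= ereal_inf S)%E.
  by apply: le_ereal_inf_tmp => l /SP[r' -> /(qh_joined_bdist openD bd)[]]; rewrite lee_fin.
have ler r' : qh_joined (D := D) x y r' -> (ereal_inf S <= r'%:E)%E.
  by move=> /Sj Sr; exact: ereal_inf_lbound.
have fin : ereal_inf S \is a fin_num.
  by rewrite ge0_fin_numE//; apply: (le_lt_trans (ler _ xyr)); rewrite ltry.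
exists (fine (ereal_inf S)) => //; split; first by rewrite -lee_fin fineK// ler.
move=> e e0; have [l /SP[r' -> j] lt] := lb_ereal_inf_adherent e0 fin.
exists r' => //; apply: ltW; rewrite -lte_fin EFinD fineK//.
Qed.

Lemma qh_dist_le x y r : qh_joined (D := D) x y r -> qh_dist D x y <= r.
Proof. by move=> /qh_dist_fin[k -> []]. Qed.

Lemma qh_dist_approx x y e : D x -> D y -> 0 < e ->
  exists2 r, qh_joined (D := D) x y r & r <= qh_dist D x y + e.
Proof.
move=> Dx Dy e0; have [r0 /qh_dist_fin[k -> [_]]] := joined Dx Dy; exact.
Qed.

Lemma qh_metric : metric_on D (qh_dist D).
Proof.
have ge0 x y : D x -> D y -> 0 <= qh_dist D x y.
  move=> Dx Dy; rewrite leNgt; apply/negP => lt.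
  have e0 : 0 < - qh_dist D x y / 2 by lra.
  have [r /(qh_joined_bdist openD bd)[r0 _]] := qh_dist_approx Dx Dy e0; lra.
have sym x y : D x -> D y -> qh_dist D x y <= qh_dist D y x.
  move=> Dx Dy; apply/ler_addgt0Pr => e e0.
  have [r j h] := qh_dist_approx Dy Dx e0; apply: le_trans h.
  exact/qh_dist_le/(qh_joined_sym openD bd).
split=> //.
- move=> x Dx; apply/eqP; rewrite eq_le ge0// andbT.
  exact/qh_dist_le/qh_joined_refl.
- by move=> x y Dx Dy; apply/eqP; rewrite eq_le !sym.
move=> x y z Dx Dy Dz; apply/ler_addgt0Pr => e e0.
have e20 : 0 < e / 2 by lra.
have [r1 j1 h1] := qh_dist_approx Dx Dy e20.
have [r2 j2 h2] := qh_dist_approx Dy Dz e20.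
have := qh_dist_le (qh_joined_trans openD bd j1 j2); lra.
Qed.

Lemma bdist_le_exp_qh x y : D x -> D y ->
  bdist D y <= bdist D x * expR (qh_dist D x y).
Proof.
move=> Dx Dy; have x0 : 0 < bdist D x by exact: bdist_gt0.
have y0 : 0 < bdist D y by exact: bdist_gt0.
rewrite mulrC -ler_pdivrMr// -[leLHS]lnK ?posrE ?divr_gt0// ler_expR.
apply/ler_addgt0Pr => e e0.
have [r /(qh_joined_bdist openD bd)[_ h] hr] := qh_dist_approx Dx Dy e0.
apply: le_trans hr; rewrite -ler_expR lnK ?posrE ?divr_gt0//.
by rewrite ler_pdivrMr// mulrC.
Qed.

Lemma arclength_clocked (g : R -> E) a b l h F : rectifiable_in D g a b ->
  arclength g a b l h -> primitive_on (fun u => (bdist D (h u))^-1) F 0 (l b) ->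
  clocked_path D (qh_dist D) h F 0 (l b).
Proof.
move=> rg al dF; case: (rg) => gD _; have hD := arclength_in gD al.
have mono := arclength_homo al; case: (al) => -[ab l0] len surj hl _.
have lb0 : 0 <= l b by rewrite -l0; exact: mono.
split=> //.
  move=> u v u0 uv vb.
  have [s [as_ sb lsu]] := surj u u0 (le_trans uv vb).
  have [t [at_ tb ltv]] := surj v (le_trans u0 uv) vb.
  have [uv'|] := eqVneq u v.
    by rewrite uv' subrr; case: qh_metric => -> //.
  move=> ne; have st : s <= t.
    rewrite leNgt; apply/negP => /ltW ts; have := mono _ _ at_ ts sb.
    by rewrite lsu ltv leNgt lt_neqAle ne uv.
  rewrite -lsu -ltv !hl//.
  apply: qh_dist_le; exists g, s, t; split=> //; first exact: rectifiable_sub rg as_ st tb.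
  exact: (qh_length_arclength openD bd gD al).
move=> u v r u0 uv vb Fu Fv.
have cF : {within `[u, v], continuous F}.
  exact: primitive_continuous (primitive_sub dF u0 vb).
have [|w] := IVT uv cF (v := r).
  by rewrite min_l ?max_r ?(le_trans Fu Fv)// Fu.
by rewrite in_itv/= => /andP[uw wv] <-; exists w.
Qed.

Lemma qh_length_metric : length_metric_on D (qh_dist D).
Proof.
move=> x y e Dx Dy e0; have [r [g [a [b [rg ga gb eg]]]] hr] := qh_dist_approx Dx Dy e0.
have [l [h al]] := arclength_exists rg; case: (rg) => gD _.
have [F dF] := arclength_primitive openD bd gD al.
case: (al) => -[ab l0] _ _ hl _.
exists h, F, 0, (l b); split.
- exact: arclength_clocked al dF.
- by rewrite -l0 hl.
- by rewrite hl.
- move: eg; rewrite (qh_length_arclength openD bd gD al dF)// l0 => -[->].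
  exact: hr.
Qed.

(** The cone condition and the Lipschitz property give
    bdist D (h 0) + s <= bdist D (h s) + 2 * s <= (1 + 2 * c) * bdist D (h s);
    integrating the resulting bound for the density gives the logarithm. *)
Lemma cone_arc_ray (c : R) (h : R -> E) (F : R -> R) (T : R) :
  0 <= c -> 0 <= T -> (forall u v, `|h v - h u| <= `|v - u|) -> (forall u, D (h u)) ->
  primitive_on (fun u => (bdist D (h u))^-1) F 0 T ->
  (forall s t, 0 <= s -> s <= t -> t <= T -> qh_dist D (h s) (h t) <= F t - F s) ->
  (forall s, 0 <= s -> s <= T -> s <= c * bdist D (h s)) ->
  john_ray D (qh_dist D) (bdist D) (1 + 2 * c) (h 0) (h T) h T.
Proof.
move=> c0 T0 hlip hD dF dist cone.
have lip := bdist_path_lipschitz bd hlip.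
have far s : 0 <= s -> s <= T -> bdist D (h 0) + s <= (1 + 2 * c) * bdist D (h s).
  move=> s0 sT; have := cone s s0 sT; have := lip s 0.
  rewrite sub0r normrN ger0_norm//; lra.
split=> //.
  move=> s s0 sT; split=> //; first exact: far.
  by have := lip 0 s; rewrite subr0 ger0_norm.
move=> s t s0 st tT; apply: (le_trans (dist s t s0 st tT)).
have x0 : 0 < bdist D (h 0) by exact: bdist_gt0.
have xs : 0 < bdist D (h 0) + s by lra.
rewrite mulrBr.
have := primitive_le st (primitive_sub dF s0 tT) (@primitive_ln R (1 + 2 * c) s t _ xs).
apply=> u su ut; have pu : 0 < bdist D (h 0) + u by lra.
have hu : 0 < bdist D (h u) by exact: bdist_gt0.
rewrite ler_pdivlMr// mulrC ler_pdivrMr//.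
by apply: far; [exact: le_trans su|exact: le_trans tT].
Qed.

End quasihyperbolic_metric.

(** * John domains *)

(** The two rays are the halves of a cone arc up to the middle of its length, the
    second one run backwards. *)
Lemma john_domain_rays (R : realType) (E : normedModType R) (D : set E) (c : R) :
  1 <= c -> john_domain c D -> boundary D !=set0 ->
  (forall x y, D x -> D y -> exists r, qh_joined (D := D) x y r) /\
  forall x y, D x -> D y -> exists m f1 T1 f2 T2,
    john_ray D (qh_dist D) (bdist D) (1 + 2 * c) x m f1 T1 /\
    john_ray D (qh_dist D) (bdist D) (1 + 2 * c) y m f2 T2.
Proof.
move=> c1 [[_ openD _] john] bd.
have joined x y : D x -> D y -> exists r, qh_joined (D := D) x y r.
  move=> Dx Dy; have [g [a [b [[rg _] <- <-]]]] := john x y Dx Dy.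
  by have [r [_ j]] := rectifiable_qh_joined openD bd rg; exists r.
split=> // x y Dx Dy; have [g [a [b [[rg cone] <- <-]]]] := john x y Dx Dy.
have [l [h al]] := arclength_exists rg; case: (rg) => gD _.
have hD := arclength_in gD al.
have [F dF] := arclength_primitive openD bd gD al.
have clk := arclength_clocked openD bd joined rg al dF.
case: (clk) => lb0 _ dist _; case: (al) => -[ab l0] len surj hl [hlip _].
case: (qh_metric openD bd joined) => _ _ sym _.
have {}cone u : 0 <= u -> u <= l b ->
    u <= c * bdist D (h u) \/ l b - u <= c * bdist D (h u).
  move=> u0 ub; have [t [at_ tb <-]] := surj u u0 ub.
  have := cone t at_ tb; rewrite !len// l0 subr0 hl// -EFin_min lee_fin ge_min.
  by move/orP.
have ha : g a = h 0 by rewrite -l0 hl.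
have hb : g b = h (l b) by rewrite hl.
move: (l b) lb0 dF dist cone hb {clk al len surj hl} => L lb0 dF dist cone hb.
have c0 : 0 <= c by lra.
have pos u : 0 <= c * bdist D (h u).
  by rewrite mulr_ge0// ltW// bdist_gt0.
exists (h (L / 2)), h, (L / 2), (fun u => h (L - u)), (L / 2).
have T0 : 0 <= L / 2 by rewrite divr_ge0.
have TL : L / 2 <= L by lra.
split.
  rewrite ha; apply: (@cone_arc_ray R E D openD bd c h F (L / 2)) => //.
  - exact: primitive_sub dF _ TL.
  - by move=> s t s0 st tT; apply: dist => //; exact: le_trans TL.
  - move=> s s0 sT; have [|//|] := cone s s0; first exact: le_trans TL.
    lra.
have -> : g b = h (L - 0) by rewrite subr0.
have -> : h (L / 2) = h (L - L / 2) by congr h; lra.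
apply: (@cone_arc_ray R E D openD bd c (fun u => h (L - u)) (fun u => - F (L - u)) (L / 2)) => //.
- move=> u v; apply: (le_trans (hlip _ _)).
  have -> : L - v - (L - u) = - (v - u) by lra.
  by rewrite normrN.
- apply: (@primitive_reflect _ (fun u => (bdist D (h u))^-1)).
  by apply: (primitive_sub dF); lra.
- move=> s t s0 st tT; rewrite sym//.
  have : qh_dist D (h (L - t)) (h (L - s)) <= F (L - s) - F (L - t).
    by apply: dist; lra.
  lra.
- by move=> s s0 sT; have [|||] := cone (L - s); lra.
Qed.

Theorem theorem1p1 (R : realType) (c c0 delta : R)
    (hc : 1 <= c) (hc0 : 1 <= c0) (hdelta : 0 <= delta) :
  exists2 b : R, 1 <= b &
    forall (E : completeNormedModType R) (D : set E),
      dim_ge2 E ->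
      D <> setT ->
      john_domain c D ->
      gromov_hyperbolic D (qh_dist D) delta ->
      forall (g : R -> E) (u v : R),
        neargeodesic D c0 g u v -> cone_arc D b g u v.
Proof.
have C1 : 1 <= 1 + 2 * c by lra.
have c00 : 0 <= c0 by lra.
have [B B1 HB] := neargeodesic_carrot C1 c00 hdelta.
exists B => // E D _ DT jD hyp g a b [rg ng]; split=> //.
case: (jD) => -[D0 openD _] _.
have bd := boundary_nonempty openD D0 DT.
have [joined rays] := john_domain_rays hc jD bd.
have [l [h al]] := arclength_exists rg; case: (rg) => gD _.
have hD := arclength_in gD al.
have [F dF] := arclength_primitive openD bd gD al.
have clk := arclength_clocked openD bd joined rg al dF.
have Ad := qh_metric openD bd joined.
have mono := arclength_homo al.
case: (clk) => lb0 _ dist _; case: (al) => -[ab l0] len surj hl [hlip _].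
have quasi u v : 0 <= u -> u <= v -> v <= l b -> F v - F u <= c0 * qh_dist D (h u) (h v).
  move=> u0 uv vb; have [s [as_ sb lsu]] := surj u u0 (le_trans uv vb).
  have [t [at_ tb ltv]] := surj v (le_trans u0 uv) vb.
  have [->|ne] := eqVneq u v.
    by rewrite subrr mulr_ge0//; case: Ad => _ + _ _; exact.
  have st : s <= t.
    rewrite leNgt; apply/negP => /ltW ts; have := mono _ _ at_ ts sb.
    by rewrite lsu ltv leNgt lt_neqAle ne uv.
  have := ng s t as_ st tb.
  by rewrite (qh_length_arclength openD bd gD al dF)// lee_fin lsu ltv -!hl// lsu ltv.
have long u v r : 0 <= u -> u <= v -> v <= l b ->
    (forall w, u <= w -> w <= v -> bdist D (h w) <= r) -> v - u <= r * (F v - F u).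
  move=> u0 uv vb hr.
  have r0 : 0 < r by apply: lt_le_trans (hr u (lexx _) uv); exact: bdist_gt0.
  rewrite -ler_pdivrMl// mulrBr.
  have := primitive_le uv (@primitive_linear _ r^-1 u v) (primitive_sub dF u0 vb).
  apply=> w uw wv; by rewrite lef_pV2 ?posrE ?bdist_gt0//; exact: hr.
move=> t at_ tb; have tl0 : 0 <= l t by rewrite -l0; exact: mono.
have tlb : l t <= l b by exact: mono.
have := HB E D (qh_dist D) (bdist D) Ad hyp (qh_length_metric openD bd joined)
  (bdist_gt0 openD bd) (bdist_le_exp_qh openD bd joined) rays h F (l b) clk quasi hD
  (bdist_path_lipschitz bd hlip) long (l t) tl0 tlb.
rewrite !len// l0 subr0 hl// -EFin_min lee_fin ge_min => H.
by apply/orP.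
Qed.
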